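(* Let $G=(V,E)$ be an undirected graph with $n=|V|$ nodes, $m$ edges and all degrees at least $1$, let $\alpha\in(0,1)$ be a constant and $\varepsilon_d>0$, and let the source $s$ be chosen at random with $\Pr[s=v]=d(v)/(2m)$ for each $v\in V$. Then the averaged per-source lower bound $\sum_{s\in V}\frac{d(s)}{2m}\cdot\frac{1}{\varepsilon_d}\sum_{t\in V}\frac{\pi(s,t)}{d(t)}$ equals $\Theta\!\left(\frac{1}{\varepsilon_d}\cdot\frac nm\right)$, and the expected running time of Algorithm D (described in the context), excluding the one-time $\Theta(m)$ preprocessing of RBS, averaged over this choice of $s$, is $\widetilde O\!\left(\frac{1}{\varepsilon_d}\sqrt{\frac nm}\right)$.
   Context: $d(v)$ is the degree of $v$ (so $\sum_v d(v)=2m$), $\mathcal N(v)$ its neighbor set. $\widetilde O(\cdot)$ suppresses $\mathrm{polylog}(n)$ factors. An $\alpha$-discounted random walk from $u$ terminates at its current node with probability $\alpha$ before each step and otherwise moves to a uniformly random neighbor; $\pi(u,v)$ is the probability that it terminates at $v$; $\pi(t)=\frac1n\sum_{v}\pi(v,t)$. Monte Carlo estimates with $k$ walks: simulate $k$ independent such walks from $s$ and estimate $\pi(s,v)$ by the fraction terminating at $v$. RBS is a randomized subroutine $\mathrm{RBS}(G,\alpha,t,\varepsilon_r,\delta,p_f)$ returning estimates $\pi'(v,t)$, $v\in V$, such that with probability at least $1-p_f$: $|\pi'(v,t)-\pi(v,t)|\le\varepsilon_r\pi(v,t)$ for all $v$ with $\pi(v,t)\ge\delta$, and $\pi'(v,t)\le\pi(v,t)+\delta$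 for all $v$ with $\pi(v,t)<\delta$; for constant $\varepsilon_r$ it runs in expected $\widetilde O(n\pi(t)/\delta)$ time after a $\Theta(m)$ preprocessing (assumed done). BackwardPush$(t,r_{\max})$: set $q(v,t)=0$ for all $v$, $r(t,t)=1$, $r(v,t)=0$ for $v\ne t$; while some $v$ has $r(v,t)>r_{\max}$, pick any such $v$, add $(1-\alpha)r(v,t)/d(u)$ to $r(u,t)$ for each $u\in\mathcal N(v)$, then add $\alpha r(v,t)$ to $q(v,t)$ and set $r(v,t)=0$; return $q,r$ (stored sparsely). Algorithm D (input $G,\alpha,s,\varepsilon_d$). Phase I: $\pi'(v,s)\leftarrow\mathrm{RBS}(G,\alpha,s,\frac12,\frac14\varepsilon_d d(s),1/n^2)$; $\pi'(s,v)=\pi'(v,s)d(v)/d(s)$ for $v$ with $\pi'(v,s)\ne0$ (else $0$); $C=\{t:\pi'(s,t)/d(t)>\frac12\varepsilon_d\}$. Phase II: $n_r=\lceil n/\varepsilon_d\rceil$, $n_t=\lceil 18\ln(2n^2)\rceil$, $r_{\max}(t)=d(t)^2\varepsilon_d^2 n_r/(6\pi'(s,t))$ for $t\in C$. Repeat: for each $t\in C$ run BackwardPush$(t,\frac12 r_{\max}(t))$, but as soon as the total cost of Backward Push in the current repetition exceeds the expected cost of simulating $n_t\cdot\frac12 n_r$ random walks, abort and leave the loop; if all $t\in C$ complete, set $n_r=\lfloor n_r/2\rfloor$, $r_{\max}(t)=\frac12 r_{\max}(t)$ for all $t\in C$, and repeat. After leaving the loop, run BackwardPush$(t,r_{\max}(t))$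 with the current values for each $t\in C$. Phase III: for $i=1,\dots,n_t$, independently compute Monte Carlo estimates $\pi''_i(s,v)$ with $n_r$ walks and set $\hat\pi_i(s,t)=q(s,t)+\sum_{v:\,r(v,t)\ne0}\pi''_i(s,v)r(v,t)$ for $t\in C$. Output the $\lceil n_t/2\rceil$-th smallest of $\hat\pi_1(s,t),\dots,\hat\pi_{n_t}(s,t)$ for $t\in C$ and $0$ for $t\notin C$. Safeguard: once the actual cost reaches $\Theta(n^2)$, the algorithm switches to the power method, solving the query in $\widetilde O(n^2)$ time.
   Formalization: Running-time bounds Õ(f) are read as Õ(max(1,f)), since any run takes at least one step while f may tend to 0; if C is empty, Algorithm D stops (the loop would never end); Backward Push picks nodes by an arbitrary fixed rule on t and the history of nodes above the threshold. *)

(* Defs.v *)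
From HB Require Import structures.
From mathcomp Require Import all_boot all_order all_algebra.
From mathcomp Require Import all_classical all_reals all_analysis.
Import Order.TTheory GRing.Theory Num.Theory.

Set Implicit Arguments.
Unset Strict Implicit.
Unset Printing Implicit Defensive.

Local Open Scope classical_set_scope.
Local Open Scope ring_scope.

Record ugraph := UGraph {
  vertex :> finType;
  adj : rel vertex;
  adj_sym : symmetric adj;
  adj_irr : irreflexive adj;
  adj_no_isolated : forall v, exists u, adj v u
}.

Section Graph.
Variable G : ugraph.

Definition order_of : nat := #|G|.

Definition edges : {set {set G}} :=
  [set [set e.1; e.2]%SET | e : G * G & adj e.1 e.2]%SET.

Definition size_of : nat := #|edges|.

Definition deg (v : G) : nat := #|[set u | adj v u]%SET|.

End Graph.

(* Running times count unit steps, so a bound O~(f) on a running time is read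
   as O~(max(1, f)): f itself may tend to 0 (e.g. sqrt(n/m) on dense graphs). *)
Definition soft_bound (R : realType) (K : R) (k n : nat) (f : R) : R :=
  K * ln n%:R ^+ k * Num.max 1 f.

(* For x >= 0. *)
Definition natceil (R : realType) (x : R) : nat := `|Num.ceil x|%N.

Section Walks.
Variables (R : realType) (alpha : R) (G : ugraph).

(* A terminated walk from u is encoded by the sequence p of nodes visited after
   u; walk_prob u p is the probability that the walk follows p, then stops. *)
Fixpoint walk_prob (u : G) (p : seq G) : R :=
  if p is v :: p' then
    (1 - alpha) * ((adj u v)%:R / (deg u)%:R) * walk_prob v p'
  else alpha.

Definition ppr (u v : G) : R :=
  fine (\esum_(p in [set p | last u p = v]) (walk_prob u p)%:E).

Definition pagerank (t : G) : R := (order_of G)%:R^-1 * \sum_(v : G) ppr v t.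

(* One unit per termination test. *)
Definition walk_cost (p : seq G) : nat := (size p).+1.

Definition mean_walk_cost (s : G) : R :=
  fine (\esum_(p in [set: seq G]) (walk_prob s p * (walk_cost p)%:R)%:E).

(* Probability of a family of independent walks from s. *)
Definition batch_prob (s : G) (I : finType) (ws : {ffun I -> seq G}) : R :=
  \prod_(i : I) walk_prob s (ws i).

End Walks.

Section BackwardPush.
Variables (R : realType) (alpha : R) (G : ugraph).

Record push_result := PushResult {
  reserve : G -> R;
  residue : G -> R;
  push_cost : nat
}.

Definition active (theta : R) (r : G -> R) : {set G} :=
  [set v | theta < r v]%SET.

(* The rule resolving "pick any such v": for target t, the set of nodes whose
   residue currently exceeds the threshold, and the list of the earlier such
   sets (latest first), it returns the next node to push. *)
Definition push_rule := G -> {set G} -> seq {set G} -> G.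

Definition push_rule_ok (pick : push_rule) : Prop :=
  forall t A h, A != finset.set0 -> pick t A h \in A.

Variable pick : push_rule.

(* A push at v costs one unit per neighbor and one for the reserve of v. *)
Definition push (v : G) (x : push_result) : push_result :=
  let q := reserve x in let r := residue x in
  PushResult
    (fun u => if u == v then q u + alpha * r v else q u)
    (fun u => if u == v then 0
              else if adj v u then r u + (1 - alpha) * r v / (deg u)%:R
              else r u)
    (push_cost x + (deg v).+1).

Fixpoint push_loop (fuel : nat) (t : G) (theta : R) (h : seq {set G})
    (x : push_result) : push_result :=
  let A := active theta (residue x) in
  if A == finset.set0 then x
  else if fuel is fuel'.+1 then
    push_loop fuel' t theta (A :: h) (push (pick t A h) x)
  else x.

(* Every push decreases \sum_u deg u * residue u, which is initially deg t, by
   more than alpha * theta; see push_fuel_enough. *)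
Definition push_fuel (t : G) (theta : R) : nat :=
  (Num.truncn ((deg t)%:R / (alpha * theta))).+1.

Definition push_init (t : G) : push_result :=
  PushResult (fun=> 0) (fun v => (v == t)%:R) 1.

Definition backward_push (t : G) (theta : R) : push_result :=
  push_loop (push_fuel t theta) t theta [::] (push_init t).

End BackwardPush.

(* Estimates together with the number of unit steps spent. *)
Definition outcome (R : realType) (G : ugraph) : Type := ((G -> R) * nat)%type.

Definition nnz (R : realType) (G : ugraph) (f : G -> R) : nat :=
  #|[set v | f v != 0]%SET|.

(* RBS(G, alpha, t, eps_r, delta, p_f), run on the random seed w : Omega. *)
Definition rbs_routine (R : realType) (Omega : Type) : Type :=
  forall G : ugraph, R -> G -> R -> R -> R -> Omega -> outcome R G.

Definition rbs_accurate (R : realType) (alpha : R) (G : ugraph) (t : G)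
    (epsr delta : R) (est : G -> R) : Prop :=
  forall v : G,
    (delta <= ppr alpha v t ->
       `|est v - ppr alpha v t| <= epsr * ppr alpha v t) /\
    (ppr alpha v t < delta -> est v <= ppr alpha v t + delta).

(* The time bound is for constant alpha and epsr, and for p_f at least inverse
   polynomial in n, so that the factor log(1/p_f) is hidden in O~. *)
Record rbs_spec (R : realType) (d : measure_display) (Omega : measurableType d)
    (P : probability Omega R) (rbs : rbs_routine R Omega) : Prop := {
  rbs_est_measurable : forall (G : ugraph) alpha (t : G) epsr delta pf (v : G),
    measurable_fun [set: Omega]
      (fun w => (rbs G alpha t epsr delta pf w).1 v);
  rbs_time_measurable : forall (G : ugraph) alpha (t : G) epsr delta pf,
    measurable_fun [set: Omega]
      (fun w => (rbs G alpha t epsr delta pf w).2%:R : R);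
  (* The estimates are returned as a list of the nonzero ones. *)
  rbs_output_size : forall (G : ugraph) alpha (t : G) epsr delta pf w,
    (nnz (rbs G alpha t epsr delta pf w).1
       <= (rbs G alpha t epsr delta pf w).2)%N;
  rbs_correct : forall (G : ugraph) alpha (t : G) epsr delta pf,
    0 < alpha < 1 -> 0 < epsr -> 0 < delta -> 0 < pf < 1 ->
    ((1 - pf)%:E <=
       P [set w | rbs_accurate alpha t epsr delta
                    (rbs G alpha t epsr delta pf w).1])%E;
  rbs_time : forall (alpha epsr : R) (c : nat), 0 < alpha < 1 -> 0 < epsr ->
    exists (K : R) (k : nat), forall (G : ugraph) (t : G) (delta pf : R),
      0 < delta -> 0 < pf < 1 -> (order_of G)%:R ^- c <= pf ->
      (\int[P]_w ((rbs G alpha t epsr delta pf w).2%:R)%:E <=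
         (soft_bound K k (order_of G)
            ((order_of G)%:R * pagerank alpha t / delta))%:E)%E
}.

(* The power method, for given G, alpha, s and eps_d. *)
Definition power_routine (R : realType) : Type :=
  forall G : ugraph, R -> G -> R -> outcome R G.

Definition power_time (R : realType) (alpha : R) (pm : power_routine R) : Prop :=
  exists (K : R) (k : nat), forall (G : ugraph) (s : G) (eps : R), 0 < eps ->
    (@pm G alpha s eps).2%:R <= soft_bound K k (order_of G) ((order_of G)%:R ^+ 2).

Definition theta_square (R : realType) (tau : nat -> nat) : Prop :=
  exists c1 c2 : R, [/\ 0 < c1, 0 < c2 & forall n : nat,
    c1 * n%:R ^+ 2 <= (tau n)%:R <= c2 * n%:R ^+ 2].

Section AlgorithmD.
Variables (R : realType) (alpha : R) (Omega : Type) (rbs : rbs_routine R Omega).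
Variables (pm : power_routine R) (tau : nat -> nat).
Variables (G : ugraph) (pick : push_rule G) (eps : R) (s : G).

Let n := order_of G.
Let bpush := @backward_push R alpha G pick.

Section PhaseI.
Variable w : Omega.

Definition phase1 : outcome R G :=
  @rbs G alpha s 2^-1 (4^-1 * eps * (deg s)%:R) (n%:R ^- 2) w.

(* pi'(s,v) *)
Definition ppr1 (v : G) : R := phase1.1 v * (deg v)%:R / (deg s)%:R.

Definition candidates : {set G} :=
  [set t | 2^-1 * eps < ppr1 t / (deg t)%:R]%SET.

Definition phase1_cost : nat :=
  (phase1.2 + nnz phase1.1)%N.

End PhaseI.

Definition nr_init : nat := natceil (n%:R / eps).
Definition nt : nat := natceil (18 * ln (2 * n%:R ^+ 2) : R).

Definition rmax_init (w : Omega) (t : G) : R :=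
  (deg t)%:R ^+ 2 * eps ^+ 2 * nr_init%:R / (6 * ppr1 w t).

Definition push_all_cost (C : {set G}) (theta : G -> R) : nat :=
  \sum_(t in C) push_cost (bpush t (theta t)).

Definition walk_budget (nr : nat) : R :=
  nt%:R * (2^-1 * nr%:R) * mean_walk_cost alpha s.

(* Returns the final n_r, r_max and the cost. A repetition aborts as soon as its
   cost, counted in unit steps (possibly inside a push), exceeds the budget,
   i.e. after floor(budget) + 1 steps. When C is nonempty it aborts at the
   latest when nr = 0, hence the fuel nr + 1 below suffices. *)
Fixpoint phase2_loop (fuel : nat) (C : {set G}) (nr : nat) (rmax : G -> R)
    (cost : nat) : nat * (G -> R) * nat :=
  if fuel is fuel'.+1 then
    let full := push_all_cost C (fun t => 2^-1 * rmax t) in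
    if walk_budget nr < full%:R then
      (nr, rmax, cost + (Num.truncn (walk_budget nr)).+1)%N
    else
      phase2_loop fuel' C nr./2 (fun t => 2^-1 * rmax t)
        (cost + full + #|C|.+1)%N
  else (nr, rmax, cost).

(* If there is no candidate, all estimates are 0 and nothing is left to do (the
   loop, taken literally, would not end). *)
Definition phase2 (w : Omega) : nat * (G -> R) * nat :=
  if candidates w == finset.set0 then (0%N, rmax_init w, 0%N)
  else phase2_loop nr_init.+1 (candidates w) nr_init (rmax_init w) 0.

Definition nr_final (w : Omega) : nat := (phase2 w).1.1.
Definition rmax_final (w : Omega) : G -> R := (phase2 w).1.2.
Definition push_final (w : Omega) (t : G) : push_result R G :=
  bpush t (rmax_final w t).

Definition phase2_cost (w : Omega) : nat :=
  ((phase2 w).2 + push_all_cost (candidates w) (rmax_final w))%N.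

(* Walk number j of the i-th Monte Carlo estimation is ws (i, j). *)
Definition batch (w : Omega) : choiceType :=
  {ffun 'I_nt * 'I_(nr_final w) -> seq G}.

Section PhaseIII.
Variables (w : Omega) (ws : batch w).

(* pi''_i(s,v) *)
Definition ppr2 (i : 'I_nt) (v : G) : R :=
  #|[set j | last s (ws (i, j)) == v]%SET|%:R / (nr_final w)%:R.

Definition trial (i : 'I_nt) (t : G) : R :=
  reserve (push_final w t) s +
  \sum_(v : G | residue (push_final w t) v != 0)
     ppr2 i v * residue (push_final w t) v.

Definition estimate (t : G) : R :=
  if t \in candidates w then
    nth 0 (sort <=%R [seq trial i t | i <- enum 'I_nt]) (uphalf nt).-1
  else 0.

(* Walks, then the sums defining the trials, then linear-time selection. *)
Definition phase3_cost : nat :=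
  (\sum_(x : 'I_nt * 'I_(nr_final w)) walk_cost (ws x) +
   nt * \sum_(t in candidates w)
          (nnz (residue (push_final w t))).+1 +
   #|candidates w| * nt)%N.

Definition unguarded : outcome R G :=
  (estimate, (phase1_cost w + phase2_cost w + phase3_cost)%N).

(* The safeguard fires when the cost reaches tau n. *)
Definition algorithmD : outcome R G :=
  if (unguarded.2 < tau n)%N then unguarded
  else ((@pm G alpha s eps).1, (tau n + (@pm G alpha s eps).2)%N).

End PhaseIII.
End AlgorithmD.

(* Expectation over the seed of RBS and, independently, over the walks. *)
Definition expected_time (R : realType) (alpha : R) (d : measure_display)
    (Omega : measurableType d) (P : probability Omega R)
    (rbs : rbs_routine R Omega) (pm : power_routine R) (tau : nat -> nat)
    (G : ugraph) (pick : push_rule G) (eps : R) (s : G) : \bar R :=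
  (\int[P]_w \esum_(ws in [set: batch alpha rbs pick eps s w])
     (batch_prob alpha s ws *
      (algorithmD pm tau ws).2%:R)%:E)%E.

Definition source_prob (R : realType) (G : ugraph) (s : G) : R :=
  (deg s)%:R / (2 * (size_of G)%:R).

Section Termination.
Variables (R : realType) (alpha : R) (G : ugraph) (pick : push_rule G).
Hypotheses (alpha01 : 0 < alpha < 1) (pick_ok : push_rule_ok pick).

Lemma deg_gt0 (v : G) : (0 < deg v)%N.
Proof.
have [u uv] := adj_no_isolated v.
by apply/card_gt0P; exists u; rewrite inE.
Qed.

Let pot (r : G -> R) := \sum_(u : G) (deg u)%:R * r u.

Lemma pot_push (v : G) (x : push_result R G) :
  pot (residue (push alpha v x)) =
  pot (residue x) - alpha * (deg v)%:R * residue x v.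
Proof.
set r := residue x; rewrite /pot /= -/r.
rewrite (bigD1 v) //= eqxx mulr0 add0r [X in _ = X - _](bigD1 v) //=.
have -> : \sum_(i | i != v) (deg i)%:R *
    (if i == v then 0
     else if adj v i then r i + (1 - alpha) * r v / (deg i)%:R else r i) =
  \sum_(i | i != v) (deg i)%:R * r i +
  \sum_(i | i != v) (if adj v i then (1 - alpha) * r v else 0).
  rewrite -big_split /=; apply: eq_bigr => i /negPf ->.
  case: ifP => _; last by rewrite addr0.
  rewrite mulrDr; congr (_ + _).
  by rewrite mulrC divfK // pnatr_eq0 -lt0n deg_gt0.
have -> : \sum_(i | i != v) (if adj v i then (1 - alpha) * r v else 0) =
    (deg v)%:R * ((1 - alpha) * r v).
  rewrite -big_mkcondr /= (eq_bigl (fun i => i \in [set u | adj v u]%SET)).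
    by rewrite sumr_const mulr_natl.
  move=> i; rewrite inE; case: eqP => [->|//]; by rewrite adj_irr.
rewrite mulrBl mul1r mulrBr [alpha * _ * _]mulrAC [X in _ = _ - X]mulrC.
by rewrite addrA; congr (_ - _); rewrite addrC.
Qed.

Lemma push_ge0 (v : G) (x : push_result R G) :
  (forall u, 0 <= residue x u) -> forall u, 0 <= residue (push alpha v x) u.
Proof.
move=> x0 u /=; case: ifP => // _; case: ifP => // _.
have /andP[_ /ltW a1] := alpha01.
by rewrite addr_ge0 // divr_ge0 // mulr_ge0 // subr_ge0.
Qed.

Lemma push_loop_halts fuel t theta h x : 0 < theta ->
  (forall u, 0 <= residue x u) ->
  pot (residue x) < fuel%:R * (alpha * theta) ->
  active theta (residue (push_loop alpha pick fuel t theta h x)) = finset.set0.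
Proof.
move=> th0; have /andP[a0 _] := alpha01.
elim: fuel h x => [|f IH] h x x0 hpot /=.
  suff : 0 <= pot (residue x) by rewrite leNgt; move: hpot; rewrite mul0r => ->.
  by apply: sumr_ge0 => u _; rewrite mulr_ge0.
case: eqP => // /eqP A0; apply: IH; first exact: push_ge0.
rewrite pot_push ltrBlDr (lt_le_trans hpot) //.
rewrite -natr1 mulrDl mul1r lerD2l -mulrA ler_pM2l //.
have := pick_ok t h A0; rewrite inE => /ltW /le_trans; apply.
by rewrite ler_peMl // ler1n deg_gt0.
Qed.

Lemma push_fuel_enough (t : G) (theta : R) : 0 < theta ->
  active theta (residue (backward_push alpha pick t theta)) = finset.set0.
Proof.
move=> th0; have /andP[a0 _] := alpha01.
apply: push_loop_halts => //=.
rewrite /pot (bigD1 t) //= eqxx mulr1 big1 => [|u /negPf ->]; last by rewrite mulr0.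
rewrite addr0 -ltr_pdivrMr ?mulr_gt0 //; exact: truncnS_gt.
Qed.

End Termination.

Lemma push_loop_cost_ge (R : realType) (alpha : R) (G : ugraph)
    (pick : push_rule G) fuel t theta h (x : push_result R G) :
  (push_cost x <= push_cost (push_loop alpha pick fuel t theta h x))%N.
Proof.
elim: fuel h x => [|f IH] h x /=; case: ifP => // _.
by apply: leq_trans (IH _ _); rewrite /= leq_addr.
Qed.

(* The loop of phase II is left by an abort, not for lack of fuel. *)
Lemma phase2_loop_exits (R : realType) (alpha : R) (G : ugraph)
    (pick : push_rule G) (s : G) fuel (C : {set G}) nr (rmax : G -> R) cost :
  C != finset.set0 -> (nr < fuel)%N ->
  let x := phase2_loop alpha pick s fuel C nr rmax cost in
  walk_budget alpha s x.1.1 <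
    (push_all_cost alpha pick C (fun t => 2^-1 * x.1.2 t))%:R.
Proof.
move=> C0; elim: fuel nr rmax cost => [//|f IH] nr rmax cost /=; rewrite ltnS => nrf.
case: ifP => [//|]; case: nr nrf => [|nr] nrf.
  rewrite /walk_budget !mulr0 mul0r ltr0n => /negP[].
  have [t tC] := set0Pn _ C0.
  rewrite /push_all_cost (bigD1 t) //= ltn_addr //.
  exact: leq_trans (push_loop_cost_ge _ _ _ _ _ _ _).
move=> _; apply: IH; apply: leq_trans nrf.
by rewrite -[X in (_ < X)%N]/(nr.+1) ltnS /= leq_uphalf_double -addnn leq_addr.
Qed.

(* Main.v *)
(* Write I(s) = \sum_t ppr t s / deg s.  Walks are reversible with respect to deg,
   so I(s) = \sum_t ppr s t / deg t, and its average over s is n / 2m.  When RBS is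
   accurate the candidates carry mass at most 3/2 I(s), and pushing at thresholds
   proportional to n_r costs at most #|C| + F, where F times the budget b of the
   walks is at most D = O~(I(s) / eps^2).  Halving n_r doubles F and halves b, so
   by AM-GM the smaller of the two stays at most (D / z + z) / 2 throughout phase II,
   for every z > 0.  It bounds both the work of the completed repetitions and the
   budget at the abort, and z = sqrt (n / m) / eps balances its average over s.
   There are O(log n) repetitions unless eps < n^-3; in that case, and when RBS
   fails (probability n^-2), the safeguard bounds the cost by O~(n^2). *)
Require Import Defs.
From HB Require Import structures.
From mathcomp Require Import all_boot all_order all_algebra.
From mathcomp Require Import all_classical all_reals all_analysis.
From mathcomp Require Import measurable_realfun.
From mathcomp Require Import ring lra zify.
Import Order.TTheory GRing.Theory Num.Theory.

Set Implicit Arguments.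
Unset Strict Implicit.
Unset Printing Implicit Defensive.

Local Open Scope classical_set_scope.
Local Open Scope ring_scope.

(** * Polylogarithmic factors and sums of nonnegative families *)

Lemma min_le_AGM (R : realFieldType) (x y D z : R) :
  0 <= x -> 0 <= y -> 0 < z -> x * y <= D -> Num.min x y <= (D / z + z) / 2.
Proof.
move=> x_ge0 y_ge0 z_gt0 xyD; set m := Num.min x y.
have m_ge0 : 0 <= m by rewrite le_min x_ge0.
have m2D : m ^+ 2 <= D.
  by apply: le_trans xyD; rewrite expr2 ler_pM // ge_min lexx ?orbT.
rewrite ler_pdivlMr // -(ler_pM2r z_gt0) [leRHS]mulrDl divfK ?gt_eqF //.
have := sqr_ge0 (m - z); lra.
Qed.

Section NatCeil.
Variable R : realType.
Implicit Types x : R.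

Lemma natceilE x : 0 <= x -> (natceil x)%:R = (Num.ceil x)%:~R :> R.
Proof.
move=> x_ge0; rewrite /natceil -[RHS]/(_%:~R) natr_absz ger0_norm //.
by rewrite -(ler_int R) (le_trans x_ge0) ?ceil_ge.
Qed.

Lemma natceil_ge x : 0 <= x -> x <= (natceil x)%:R.
Proof. by move=> x_ge0; rewrite natceilE ?ceil_ge. Qed.

Lemma natceil_ltD1 x : 0 <= x -> (natceil x)%:R < x + 1.
Proof.
move=> x_ge0; rewrite natceilE // -ltrBlDr.
by have /andP[+ _] := ceil_itv x; rewrite intrB.
Qed.

End NatCeil.

Section PolyLog.
Variable R : realType.
Implicit Types f g : nat -> R.

Lemma ln_nat_ge0 (n : nat) : 0 <= ln n%:R :> R.
Proof. by case: n => [|n]; [rewrite ln0|rewrite ln_ge0 // ler1n]. Qed.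

Lemma half_le_ln_nat (n : nat) : (1 < n)%N -> 2^-1 <= ln n%:R :> R.
Proof.
move=> n_gt1; apply: (@le_trans _ _ (ln 2)); last first.
  by rewrite ler_ln ?posrE ?ltr0n ?ler_nat // ltnW.
have := @le_ln1Dx R (- 2^-1); rewrite (_ : 1 + - 2^-1 = 2^-1); last by lra.
by rewrite lnV ?posrE // => le_ln; rewrite -lerN2 le_ln //; lra.
Qed.

Definition polylog f : Prop :=
  exists K k, forall n, (1 < n)%N -> `|f n| <= K * ln n%:R ^+ k.

Lemma polylog_monomial (K : R) k : polylog (fun n => K * ln n%:R ^+ k).
Proof.
exists `|K|, k => n _; rewrite normrM normrX.
by rewrite (ger0_norm (ln_nat_ge0 n)).
Qed.

Lemma polylog_cst (x : R) : polylog (fun=> x).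
Proof. by exists `|x|, 0 => n _; rewrite expr0 mulr1. Qed.

Lemma polylogD f g : polylog f -> polylog g -> polylog (fun n => f n + g n).
Proof.
move=> [K [k fK]] [M [m gM]]; exists (K * 2 ^+ m + M * 2 ^+ k), (k + m)%N => n n_gt1.
have twice_ln_ge1 i : 1 <= (2 * ln n%:R) ^+ i :> R.
  by rewrite exprn_ege1 // -ler_pdivrMl // mulr1 half_le_ln_nat.
apply: le_trans (ler_normD _ _) _; rewrite mulrDl lerD //.
- apply: (le_trans (fK n n_gt1)).
  rewrite exprD mulrACA [_ * ln _ ^+ m]mulrC -mulrA -exprMn [ln _ * 2]mulrC.
  by rewrite mulrA ler_peMr // (le_trans _ (fK n n_gt1)).
- apply: (le_trans (gM n n_gt1)).
  rewrite [(k + m)%N]addnC exprD mulrACA -exprMn.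
  by rewrite ler_peMr // (le_trans _ (gM n n_gt1)).
Qed.

Lemma polylogM f g : polylog f -> polylog g -> polylog (fun n => f n * g n).
Proof.
move=> [K [k fK]] [M [m gM]]; exists (K * M), (k + m)%N => n n_gt1.
by rewrite normrM exprD mulrACA ler_pM ?fK ?gM.
Qed.

Lemma soft_bound_ge0 (K : R) k n x : 0 <= K -> 0 <= soft_bound K k n x.
Proof. by move=> K_ge0; rewrite !mulr_ge0 ?exprn_ge0 ?ln_nat_ge0 // le_max ler01. Qed.

Lemma soft_bound_le_norm (K : R) k n x :
  soft_bound K k n x <= `|K| * ln n%:R ^+ k * Num.max 1 x.
Proof.
by rewrite !ler_wpM2r ?exprn_ge0 ?ln_nat_ge0 ?ler_norm // le_max ler01.
Qed.

Lemma polylog_mul_le_soft_bound f (b : R) : polylog f -> 0 <= b ->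
  exists K k, 0 <= K /\ forall n x y, (1 < n)%N -> 0 <= y <= b * Num.max 1 x ->
    f n * y <= soft_bound K k n x.
Proof.
move=> [K [k fK]] b_ge0; exists (`|K| * b), k; split; first by rewrite mulr_ge0.
move=> n x y n_gt1 /andP[y_ge0 y_le]; rewrite /soft_bound -[leRHS]mulrA mulrACA.
apply: (@le_trans _ _ (`|f n| * y)); first by rewrite ler_wpM2r ?ler_norm.
apply: ler_pM => //; apply: (le_trans (fK n n_gt1)).
by rewrite ler_wpM2r ?ler_norm // exprn_ge0 // ln_nat_ge0.
Qed.

End PolyLog.

Section NonnegativeSums.
Variable R : realType.

Lemma esum_finType (T : finType) (f : T -> \bar R) :
  (forall x, 0 <= f x)%E -> (\esum_(x in [set: T]) f x = \sum_x f x)%E.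
Proof.
move=> f_ge0; rewrite esum_fset //; last exact: finite_finset.
rewrite [RHS]fsbig_seq ?index_enum_uniq //; apply: eq_fsbigl.
by apply/seteqP; split => x //= _; rewrite mem_index_enum.
Qed.

Lemma esumZl (T : choiceType) (S : set T) (c : R) (f : T -> \bar R) :
  0 <= c -> (forall x, 0 <= f x)%E ->
  (\esum_(x in S) (c%:E * f x) = c%:E * \esum_(x in S) f x)%E.
Proof.
move=> c_ge0 f_ge0; rewrite /esum -ereal_supZl //; last first.
  by apply/set0P; exists (\sum_(x \in set0) f x)%E, set0 => //; apply: fsets_set0.
rewrite image_comp; congr ereal_sup; apply: eq_imagel => X _ /=.
by rewrite ge0_mule_fsumr.
Qed.

Lemma esum_prod_ffun_le (I : finType) (T : choiceType) (F : I -> T -> R)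
    (M : I -> R) :
  (forall i x, 0 <= F i x) ->
  (forall i, \esum_(x in [set: T]) (F i x)%:E <= (M i)%:E)%E ->
  (\esum_(h in [set: {ffun I -> T}]) (\prod_i F i (h i))%:E
   <= (\prod_i M i)%:E)%E.
Proof.
move=> F_ge0 F_le; apply: ge_ereal_sup => _ [X [X_fin _] <-].
pose box := [seq h i | h : {ffun I -> T} <- finmap.enum_fset (fset_set X), i <- enum I].
pose B := seq_sub box.
pose val_ffun (h : {ffun I -> B}) : {ffun I -> T} := [ffun i => val (h i)].
have val_ffun_inj : injective val_ffun.
  by move=> h k /ffunP E; apply/ffunP => i; apply: val_inj; have := E i; rewrite !ffunE.
have X_sub : X `<=` range val_ffun.
  move=> h hX; have h_box i : h i \in box.
    apply/allpairsP; exists (h, i).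
    by rewrite /= mem_enum in_fset_set // mem_set.
  by exists [ffun i => SeqSub (h_box i)] => //; apply/ffunP => i; rewrite !ffunE.
rewrite -esum_fset //; last by move=> h _; rewrite lee_fin prodr_ge0.
apply: (@le_trans _ _ (\esum_(h in range val_ffun) (\prod_i F i (h i))%:E)%E).
  rewrite esum_mkcond [leRHS]esum_mkcond; apply: le_esum => h _.
  case: ifPn => [/set_mem /X_sub hX|_]; first by rewrite mem_set.
  by case: ifP => // _; rewrite lee_fin prodr_ge0.
rewrite esum_image; last by move=> h k _ _; apply: val_ffun_inj.
rewrite esum_finType; last by move=> h; rewrite lee_fin prodr_ge0.
rewrite (eq_bigr (fun h : {ffun I -> B} => (\prod_i F i (val (h i)))%:E)); last first.
  by move=> h _; congr EFin; apply: eq_bigr => i _; rewrite ffunE.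
rewrite sumEFin lee_fin -(bigA_distr_bigA (fun i (x : B) => F i (val x))) /=.
apply: ler_prod => i _; rewrite sumr_ge0 //= -lee_fin; apply: le_trans (F_le i).
rewrite -sumEFin -(esum_finType (f := fun x : B => (F i (val x))%:E)).
  rewrite -(esum_image [set: B] (fun x => val x) (fun x => (F i x)%:E)).
    by rewrite esum_mkcond; apply: le_esum => x _; case: ifP; rewrite // lee_fin.
  by move=> x y _ _; apply: val_inj.
by move=> x; rewrite lee_fin.
Qed.

End NonnegativeSums.

(** * Random walks on graphs *)

Section GraphCounting.
Variable G : ugraph.
Implicit Types v : G.

Lemma sum_deg_card_darts :
  (\sum_(v : G) deg v = #|[set e : G * G | adj e.1 e.2]%SET|)%N.
Proof.
rewrite -sum1dep_card -(pair_big_dep xpredT (fun u v => @adj G u v) (fun _ _ => 1%N)).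
by apply: eq_bigr => v _; rewrite sum1dep_card.
Qed.

Lemma card_darts_of_edge (E : {set G}) : E \in edges G ->
  #|[pred e : G * G | adj e.1 e.2 && ([set e.1; e.2]%SET == E)]| = 2%N.
Proof.
case/imsetP => -[a b]; rewrite inE /= => ab ->.
have neq_ab : a != b by apply: contraTneq ab => ->; rewrite adj_irr.
rewrite -[RHS](_ : #|[set (a, b); (b, a)]%SET| = 2%N); last first.
  by rewrite cards2 xpair_eqE (negPf neq_ab).
apply: eq_card => -[x y]; rewrite !inE !xpair_eqE /=; apply/idP/idP; last first.
  by case/orP => /andP[/eqP-> /eqP->]; rewrite ?eqxx ?ab // finset.setUC adj_sym ab eqxx.
case/andP => xy /eqP Exy.
have neq_xy : x != y by apply: contraTneq xy => ->; rewrite adj_irr.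
have : x \in [set a; b]%SET by rewrite -Exy !inE eqxx.
have : y \in [set a; b]%SET by rewrite -Exy !inE eqxx orbT.
rewrite !inE => /orP[] /eqP yE /orP[] /eqP xE; move: neq_xy;
  by rewrite yE xE ?eqxx // orbT.
Qed.

Lemma handshake : (\sum_(v : G) deg v = 2 * size_of G)%N.
Proof.
rewrite sum_deg_card_darts -sum1dep_card.
rewrite (partition_big (fun e : G * G => [set e.1; e.2]%SET) (mem (edges G))) /=; last first.
  by move=> e e_adj; apply/imsetP; exists e; rewrite ?inE.
rewrite mulnC -sum_nat_const; apply: eq_bigr => E E_edge.
by rewrite sum1_card card_darts_of_edge.
Qed.

Lemma order_le_size : (order_of G <= 2 * size_of G)%N.
Proof.
by rewrite -handshake /order_of -sum1_card leq_sum // => v _; apply: deg_gt0.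
Qed.

Lemma size_le_square : (size_of G <= order_of G ^ 2)%N.
Proof.
rewrite (leq_trans (leq_imset_card _ _)) //.
by rewrite (leq_trans (max_card _)) // card_prod expnS expn1.
Qed.

Lemma order_gt1 : G -> (1 < order_of G)%N.
Proof.
move=> v; have [u uv] := adj_no_isolated v.
rewrite (leq_trans (_ : _ <= #|[set u; v]%SET|)%N) ?max_card // cards2.
by case: eqP uv => // ->; rewrite adj_irr.
Qed.

Lemma size_gt0 : (0 < order_of G)%N -> (0 < size_of G)%N.
Proof. by have := order_le_size; lia. Qed.

Lemma degr_gt0 (R : numDomainType) v : 0 < (deg v)%:R :> R.
Proof. by rewrite ltr0n deg_gt0. Qed.

Lemma source_prob_ge0 (R : realType) (s : G) : 0 <= source_prob R s.
Proof. by rewrite divr_ge0 // mulr_ge0. Qed.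

Lemma sum_source_prob (R : realType) :
  (0 < order_of G)%N -> \sum_(s : G) source_prob R s = 1.
Proof.
move=> /size_gt0 m_gt0; rewrite -mulr_suml -natr_sum handshake natrM divff //.
by rewrite mulf_neq0 // pnatr_eq0 -lt0n.
Qed.

End GraphCounting.

Lemma geometric_mean_partial (R : comNzRingType) (x : R) N :
  x * (\sum_(0 <= k < N) x * (1 - x) ^+ k * k.+1%:R) =
  1 - (1 - x) ^+ N * (1 + N%:R * x).
Proof.
elim: N => [|N IH]; first by rewrite big_geq //; ring.
by rewrite big_nat_recr //= mulrDr IH exprS -natr1; ring.
Qed.

Section WalkMass.
Variables (R : realType) (alpha : R) (G : ugraph).
Hypothesis alpha01 : 0 < alpha < 1.
Let alpha_gt0 : 0 < alpha. Proof. by case/andP: alpha01. Qed.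
Let stay_ge0 : 0 <= 1 - alpha.
Proof. by rewrite subr_ge0 ltW //; case/andP: alpha01. Qed.
Implicit Types (u v s t : G) (p : seq G).

Lemma walk_prob_ge0 u p : 0 <= walk_prob alpha u p.
Proof.
by elim: p u => [|v p IH] u /=; rewrite ?(ltW alpha_gt0) // !mulr_ge0 // invr_ge0.
Qed.

Lemma sum_adj_div_deg u : \sum_v (adj u v)%:R / (deg u)%:R = 1 :> R.
Proof.
rewrite -mulr_suml -natr_sum (_ : (\sum_v adj u v)%N = deg u).
  by rewrite divff // gt_eqF // degr_gt0.
by rewrite /deg -sum1dep_card [RHS]big_mkcond; apply: eq_bigr => v _; case: adj.
Qed.

Lemma sum_walk_prob_tuple u k :
  \sum_(p : k.-tuple G) walk_prob alpha u p = alpha * (1 - alpha) ^+ k.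
Proof.
elim: k u => [|k IH] u.
  rewrite (bigD1 [tuple]) //= big1 ?addr0 ?expr0 ?mulr1 // => p.
  by rewrite [p]tuple0 => /eqP.
pose cons_pair (x : G * k.-tuple G) : k.+1.-tuple G := [tuple of x.1 :: x.2].
rewrite (reindex cons_pair) /=; last first.
  exists (fun p : k.+1.-tuple G => (thead p, [tuple of behead p])) => [[v p] _|p _] /=.
    by congr (_, _); apply: val_inj.
  by apply: val_inj; rewrite /= [in RHS](tuple_eta p).
rewrite -(pair_bigA _ (fun v (p : k.-tuple G) => walk_prob alpha u (v :: p))) /=.
under eq_bigr => v _ do rewrite -mulr_sumr IH mulrAC.
by rewrite -mulr_sumr sum_adj_div_deg mulr1 exprS mulrCA mulrA.
Qed.

Lemma esum_walk_size u (g : nat -> R) : (forall k, 0 <= g k) ->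
  (\esum_(p in [set: seq G]) (walk_prob alpha u p * g (size p))%:E =
   \sum_(0 <= k <oo) (alpha * (1 - alpha) ^+ k * g k)%:E)%E.
Proof.
move=> g_ge0.
have term_ge0 p : (0 <= (walk_prob alpha u p * g (size p))%:E)%E.
  by rewrite lee_fin mulr_ge0 // walk_prob_ge0.
have -> : [set: seq G] = \bigcup_k [set p | size p = k].
  by apply/seteqP; split => p // _; exists (size p).
rewrite nneseries_sum_bigcup //; last by move=> i j _ _ [p [/= <- <-]].
apply: eq_eseriesr => k _.
rewrite (@reindex_esum _ _ _ [set: k.-tuple G] _ (@tval k G)); last first.
  split=> [p _ /=|p q _ _|p /= pk]; [exact: size_tuple|exact: val_inj|].
  by exists (Tuple (introT eqP pk)).
rewrite esum_finType // sumEFin -[in RHS](sum_walk_prob_tuple u) mulr_suml.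
by congr EFin; apply: eq_bigr => p _; rewrite size_tuple.
Qed.

Lemma esum_walk_prob u : (\esum_(p in [set: seq G]) (walk_prob alpha u p)%:E = 1)%E.
Proof.
transitivity (\sum_(0 <= k <oo) (alpha * (1 - alpha) ^+ k * 1)%:E)%E.
  by rewrite -(esum_walk_size u) //; apply: eq_esum => p _; rewrite mulr1.
apply/cvg_lim => //; apply: cvg_EFin; first by apply: nearW => k; rewrite sumEFin.
rewrite [X in X @ _ --> _](_ : _ = series (geometric alpha (1 - alpha))); last first.
  by apply/funext => k /=; rewrite sumEFin /=; apply: eq_bigr => i _; rewrite mulr1.
have /(@cvg_geometric_series _ alpha) : `|1 - alpha| < 1.
  by rewrite ger0_norm // ltrBlDr ltrDl.
by rewrite subKr divff ?gt_eqF.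
Qed.

Lemma esum_walk_cost_le u :
  (\esum_(p in [set: seq G]) (walk_prob alpha u p * (walk_cost p)%:R)%:E
   <= (alpha^-1)%:E)%E.
Proof.
rewrite (esum_walk_size u (g := fun k => k.+1%:R)) //.
have term_ge0 k : 0 <= alpha * (1 - alpha) ^+ k * k.+1%:R.
  by rewrite !mulr_ge0 ?exprn_ge0 // ltW.
apply: lime_le; first by apply: is_cvg_nneseries => k _ _; rewrite lee_fin.
apply: nearW => N; rewrite sumEFin lee_fin -(ler_pM2l alpha_gt0).
rewrite geometric_mean_partial divff ?gt_eqF // lerBlDr lerDl.
by rewrite mulr_ge0 ?exprn_ge0 // addr_ge0 // mulr_ge0 // ltW.
Qed.

Lemma esum_walk_cost u :
  (\esum_(p in [set: seq G]) (walk_prob alpha u p * (walk_cost p)%:R)%:E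
   = (mean_walk_cost alpha u)%:E)%E.
Proof.
rewrite /mean_walk_cost fineK // ge0_fin_numE; last first.
  by apply: esum_ge0 => p _; rewrite lee_fin mulr_ge0 ?walk_prob_ge0.
exact: le_lt_trans (esum_walk_cost_le u) (ltry _).
Qed.

Lemma mean_walk_cost_le u : mean_walk_cost alpha u <= alpha^-1.
Proof. by rewrite -lee_fin -esum_walk_cost esum_walk_cost_le. Qed.

Lemma mean_walk_cost_ge0 u : 0 <= mean_walk_cost alpha u.
Proof.
rewrite -lee_fin -esum_walk_cost esum_ge0 // => p _.
by rewrite lee_fin mulr_ge0 ?walk_prob_ge0.
Qed.

Lemma esum_ppr u v :
  (\esum_(p in [set p | last u p = v]) (walk_prob alpha u p)%:E
   = (ppr alpha u v)%:E)%E.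
Proof.
have prob_ge0 p : (0 <= (walk_prob alpha u p)%:E)%E by rewrite lee_fin walk_prob_ge0.
rewrite /ppr fineK // ge0_fin_numE; last exact: esum_ge0.
apply: le_lt_trans (ltry 1); rewrite -(esum_walk_prob u) esum_mkcond.
by apply: le_esum => p _; case: ifP.
Qed.

Lemma ppr_ge0 u v : 0 <= ppr alpha u v.
Proof.
by rewrite -lee_fin -esum_ppr esum_ge0 // => p _; rewrite lee_fin walk_prob_ge0.
Qed.

Lemma sum_ppr u : \sum_v ppr alpha u v = 1.
Proof.
apply: EFin_inj; rewrite -sumEFin.
under eq_bigr => v _ do rewrite -esum_ppr esum_mkcond.
rewrite -esum_sum; last by move=> p v _ _; case: ifP => // _; rewrite lee_fin walk_prob_ge0.
rewrite -[RHS](esum_walk_prob u); apply: eq_esum => p _.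
rewrite (bigD1 (last u p)) //= mem_set // big1 ?adde0 // => v vp.
by rewrite memNset //= => pv; rewrite pv eqxx in vp.
Qed.

Definition rev_walk u p : seq G := rev (belast u p).

Lemma rev_cons_walk u p : rev (u :: p) = last u p :: rev_walk u p.
Proof. by rewrite lastI rev_rcons. Qed.

Lemma rev_walkK u p : rev_walk (last u p) (rev_walk u p) = p.
Proof.
by have := rev_cons_walk (last u p) (rev_walk u p); rewrite -rev_cons_walk revK => -[].
Qed.

Lemma last_rev_walk u p : last (last u p) (rev_walk u p) = u.
Proof. by have /(congr1 (last u)) := rev_cons_walk u p; rewrite rev_cons last_rcons. Qed.

Lemma walk_prob_rcons u p v :
  walk_prob alpha u (rcons p v) =
  walk_prob alpha u p * ((1 - alpha) * ((adj (last u p) v)%:R / (deg (last u p))%:R)).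
Proof. by elim: p u => [|w p IH] u /=; [rewrite mulrC | rewrite IH mulrA]. Qed.

Lemma walk_prob_rev u p :
  (deg u)%:R * walk_prob alpha u p =
  (deg (last u p))%:R * walk_prob alpha (last u p) (rev_walk u p).
Proof.
elim: p u => [//|v p IH] u; rewrite /rev_walk /= rev_cons walk_prob_rcons.
rewrite -/(rev_walk v p) last_rev_walk mulrA -IH [adj v u]adj_sym.
by field; rewrite !gt_eqF // degr_gt0.
Qed.

Lemma ppr_reversible u v :
  (deg u)%:R * ppr alpha u v = (deg v)%:R * ppr alpha v u.
Proof.
apply: EFin_inj; rewrite !EFinM -!esum_ppr.
have prob_ge0 x p : (0 <= (walk_prob alpha x p)%:E)%E by rewrite lee_fin walk_prob_ge0.
rewrite [in RHS](@reindex_esum _ _ _ [set p | last u p = v] _ (rev_walk u)); last first.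
  split=> [p /= <-|p q|p /= pu]; first exact: last_rev_walk.
    by rewrite !inE /= => pv qv E; rewrite -(rev_walkK u p) -(rev_walkK u q) pv qv E.
  by exists (rev_walk v p); rewrite -pu ?rev_walkK //= last_rev_walk.
rewrite -!esumZl //; apply: eq_esum => p /= <-.
by rewrite -!EFinM walk_prob_rev.
Qed.

End WalkMass.

Definition inflow (R : realType) (alpha : R) (G : ugraph) (s : G) : R :=
  (\sum_v ppr alpha v s) / (deg s)%:R.

Section Inflow.
Variables (R : realType) (alpha : R) (G : ugraph).
Hypothesis alpha01 : 0 < alpha < 1.

Lemma inflow_ge0 (s : G) : 0 <= inflow alpha s.
Proof. by rewrite divr_ge0 // sumr_ge0 // => v _; apply: ppr_ge0. Qed.

Lemma sum_ppr_div_deg (s : G) : \sum_t ppr alpha s t / (deg t)%:R = inflow alpha s.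
Proof.
have deg_neq0 (v : G) : (deg v)%:R != 0 :> R by rewrite gt_eqF // degr_gt0.
rewrite /inflow mulr_suml; apply: eq_bigr => t _; apply/eqP.
by rewrite eqr_div // mulrC ppr_reversible // mulrC.
Qed.

Lemma sum_source_prob_inflow :
  \sum_(s : G) source_prob R s * inflow alpha s =
  (order_of G)%:R / (2 * (size_of G)%:R).
Proof.
transitivity ((\sum_(s : G) \sum_v ppr alpha v s) / (2 * (size_of G)%:R)).
  rewrite mulr_suml; apply: eq_bigr => s _; rewrite /source_prob /inflow.
  by rewrite mulrC mulrA divfK // gt_eqF // degr_gt0.
rewrite exchange_big /=; congr (_ / _).
by under eq_bigr do rewrite sum_ppr //; rewrite sumr_const.
Qed.

Lemma average_source_lower_boundE (eps : R) :
  \sum_(s : G) source_prob R s * (eps^-1 * \sum_(t : G) ppr alpha s t / (deg t)%:R) =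
  2^-1 * (eps^-1 * ((order_of G)%:R / (size_of G)%:R)).
Proof.
under eq_bigr do rewrite sum_ppr_div_deg mulrCA.
by rewrite -mulr_sumr sum_source_prob_inflow invfM; ring.
Qed.

End Inflow.

Section BatchExpectation.
Variables (R : realType) (alpha : R) (G : ugraph) (s : G) (I : finType).
Hypothesis alpha01 : 0 < alpha < 1.
Implicit Types ws : {ffun I -> seq G}.

Lemma batch_prob_ge0 ws : 0 <= batch_prob alpha s ws.
Proof. by apply: prodr_ge0 => i _; apply: walk_prob_ge0. Qed.

Lemma esum_batch_prob_le1 :
  (\esum_(ws in [set: {ffun I -> seq G}]) (batch_prob alpha s ws)%:E <= 1)%E.
Proof.
have := @esum_prod_ffun_le R I _ (fun=> walk_prob alpha s) (fun=> 1).
rewrite big1_eq; apply=> i; first exact: walk_prob_ge0.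
by rewrite esum_walk_prob.
Qed.

Lemma esum_batch_walk_cost_le (x : I) :
  (\esum_(ws in [set: {ffun I -> seq G}])
     (batch_prob alpha s ws * (walk_cost (ws x))%:R)%:E
   <= (mean_walk_cost alpha s)%:E)%E.
Proof.
pose F i (p : seq G) := walk_prob alpha s p * (if i == x then (walk_cost p)%:R else 1).
have -> : mean_walk_cost alpha s = \prod_i (if i == x then mean_walk_cost alpha s else 1).
  by rewrite -big_mkcond big_pred1_eq.
rewrite (_ : (\esum_(ws in _) _)%E =
    (\esum_(ws in [set: {ffun I -> seq G}]) (\prod_i F i (ws i))%:E)%E).
  apply: esum_prod_ffun_le => i; rewrite /F; case: (i == x).
  - by move=> p; rewrite mulr_ge0 ?walk_prob_ge0.
  - by move=> p; rewrite mulr1 walk_prob_ge0.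
  - by rewrite esum_walk_cost.
  - by rewrite -(esum_walk_prob alpha01 s); apply: le_esum => p _; rewrite mulr1.
apply: eq_esum => ws _; congr EFin; rewrite big_split; congr (_ * _).
by rewrite -big_mkcond big_pred1_eq.
Qed.

Lemma esum_batch_affine_cost_le (a b : R) : 0 <= a -> 0 <= b ->
  (\esum_(ws in [set: {ffun I -> seq G}])
     (batch_prob alpha s ws * (a + b * \sum_x (walk_cost (ws x))%:R))%:E
   <= (a + b * (#|I|%:R * mean_walk_cost alpha s))%:E)%E.
Proof.
move=> a_ge0 b_ge0.
have term_ge0 x ws : (0 <= (batch_prob alpha s ws * (walk_cost (ws x))%:R)%:E)%E.
  by rewrite lee_fin mulr_ge0 ?batch_prob_ge0.
rewrite (_ : (\esum_(ws in _) _)%E = (\esum_(ws in [set: {ffun I -> seq G}])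
    (a%:E * (batch_prob alpha s ws)%:E +
     b%:E * \sum_x (batch_prob alpha s ws * (walk_cost (ws x))%:R)%:E))%E); last first.
  apply: eq_esum => ws _; rewrite sumEFin -!EFinM -EFinD -mulr_sumr.
  by congr EFin; ring.
rewrite esumD; last 2 first.
- by move=> ws _; rewrite -EFinM lee_fin mulr_ge0 // batch_prob_ge0.
- by move=> ws _; rewrite mule_ge0 ?lee_fin // sume_ge0.
rewrite esumZl // ?esumZl //; last by move=> ws; rewrite lee_fin batch_prob_ge0.
  rewrite EFinD; apply: leeD.
    by rewrite -[leRHS]mule1 lee_wpmul2l ?lee_fin // esum_batch_prob_le1.
  rewrite EFinM lee_wpmul2l ?lee_fin // esum_sum //.
  rewrite mulr_natl -sumr_const -sumEFin; apply: lee_sum => x _.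
  exact: esum_batch_walk_cost_le.
by move=> ws; rewrite sume_ge0.
Qed.

End BatchExpectation.

(** * Backward Push and the loop of phase II *)

Section PushCost.
Variables (R : realType) (alpha : R) (G : ugraph) (pick : push_rule G).
Implicit Types (t v : G) (x : push_result R G).

Lemma nnz_residue_push v x :
  (nnz (residue (push alpha v x)) <= nnz (residue x) + deg v)%N.
Proof.
rewrite /nnz (leq_trans _ (leq_card_setU _ _)) //; apply: subset_leq_card.
apply/fintype.subsetP => u; rewrite !inE /=; case: ifP => _; first by rewrite eqxx.
by case: ifP => _ xu; rewrite ?orbT ?orbF.
Qed.

Lemma nnz_residue_push_loop fuel t theta h x :
  (nnz (residue x) <= push_cost x)%N ->
  (nnz (residue (push_loop alpha pick fuel t theta h x)) <=
   push_cost (push_loop alpha pick fuel t theta h x))%N.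
Proof.
elim: fuel h x => [|f IH] h x /= le_x; case: ifP => // _.
by apply: IH; rewrite (leq_trans (nnz_residue_push _ _)) //= leq_add.
Qed.

Lemma nnz_residue_backward_push t theta :
  (nnz (residue (backward_push alpha pick t theta)) <=
   push_cost (backward_push alpha pick t theta))%N.
Proof.
apply: nnz_residue_push_loop => /=; rewrite -[leqRHS](cards1 t) subset_leq_card //.
by apply/fintype.subsetP => u; rewrite !inE; case: (u == t); rewrite ?eqxx.
Qed.

Lemma backward_push_cost_gt0 t theta :
  (0 < push_cost (backward_push alpha pick t theta))%N.
Proof. exact: leq_trans (push_loop_cost_ge _ _ _ _ _ _ _). Qed.

Hypotheses (alpha01 : 0 < alpha < 1) (pick_ok : push_rule_ok pick).
Let alpha_gt0 : 0 < alpha. Proof. by case/andP: alpha01. Qed.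

(* The potential \sum_u deg u * residue u pays for the pushes: a push at v costs
   (deg v).+1 <= 2 * deg v and lowers it by at least alpha * theta * deg v. *)
Lemma push_loop_cost_le fuel t theta h x :
  0 < theta -> (forall u, 0 <= residue x u) ->
  (push_cost (push_loop alpha pick fuel t theta h x))%:R * (alpha * theta) <=
  (push_cost x)%:R * (alpha * theta) + 2 * \sum_u (deg u)%:R * residue x u.
Proof.
move=> theta_gt0; elim: fuel h x => [|f IH] h x x_ge0 /=; case: eqP => [_|/eqP A_neq0];
  try by rewrite lerDl mulr_ge0 // sumr_ge0 // => u _; rewrite mulr_ge0.
set v := pick t _ h; apply: (le_trans (IH _ _ (push_ge0 alpha01 v x_ge0))).
have /= -> := pot_push alpha v x.
have theta_le : theta <= residue x v by have := pick_ok t h A_neq0; rewrite inE => /ltW.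
have degS_le : (deg v).+1%:R <= 2 * (deg v)%:R :> R.
  by rewrite -natrM ler_nat mul2n -addnn -addn1 leq_add2l deg_gt0.
rewrite natrD mulrDl -addrA lerD2l mulrBr addrCA gerDl subr_le0.
rewrite (le_trans (ler_wpM2r _ degS_le)) ?mulr_ge0 ?(ltW alpha_gt0) ?(ltW theta_gt0) //.
by rewrite -!mulrA ler_pM2l // mulrCA ler_pM2l // ler_wpM2l.
Qed.

Lemma backward_push_cost_le t theta : 0 < theta ->
  (push_cost (backward_push alpha pick t theta))%:R <=
  1 + 2 * (deg t)%:R / (alpha * theta).
Proof.
move=> theta_gt0; have at_gt0 : 0 < alpha * theta by rewrite mulr_gt0.
rewrite -(ler_pM2r at_gt0) mulrDl divfK ?gt_eqF //.
apply: le_trans (push_loop_cost_le _ _ _ theta_gt0 _) _ => //=.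
by rewrite (bigD1 t) //= eqxx mulr1 big1 ?addr0 // => u /negPf ->; rewrite mulr0.
Qed.

End PushCost.

Section Phase2Loop.
Variables (R : realType) (alpha : R) (G : ugraph) (pick : push_rule G) (s : G).
Hypotheses (alpha01 : 0 < alpha < 1) (pick_ok : push_rule_ok pick).
Let alpha_gt0 : 0 < alpha. Proof. by case/andP: alpha01. Qed.
Variable C : {set G}.
Implicit Types rmax : G -> R.

Let half rmax : G -> R := fun t => 2^-1 * rmax t.

Definition push_charge rmax : R := \sum_(t in C) 2 * (deg t)%:R / (alpha * rmax t).

Lemma push_charge_half rmax : push_charge (half rmax) = 2 * push_charge rmax.
Proof.
rewrite /push_charge mulr_sumr; apply: eq_bigr => t _.
by rewrite /half mulrCA invfM invrK [RHS]mulrCA !mulrA.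
Qed.

Lemma push_charge_ge0 rmax : (forall t, t \in C -> 0 < rmax t) -> 0 <= push_charge rmax.
Proof.
move=> rmax_gt0; apply: sumr_ge0 => t tC.
by rewrite divr_ge0 ?mulr_ge0 ?(ltW alpha_gt0) // ltW // rmax_gt0.
Qed.

Lemma push_all_cost_le rmax : (forall t, t \in C -> 0 < rmax t) ->
  (push_all_cost alpha pick C rmax)%:R <= #|C|%:R + push_charge rmax.
Proof.
move=> rmax_gt0; rewrite natr_sum -[in leRHS]sum1_card natr_sum -big_split /=.
by apply: ler_sum => t tC; apply: backward_push_cost_le => //; apply: rmax_gt0.
Qed.

Lemma push_all_cost_gt0 rmax : C != finset.set0 -> (0 < push_all_cost alpha pick C rmax)%N.
Proof.
move=> /finset.set0Pn[t tC].
by rewrite /push_all_cost (bigD1 t) //= ltn_addr // backward_push_cost_gt0.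
Qed.

Lemma walk_budget_ge0 nr : 0 <= walk_budget alpha s nr.
Proof. by rewrite !mulr_ge0 // mean_walk_cost_ge0. Qed.

Lemma walk_budget_half nr : walk_budget alpha s nr./2 <= 2^-1 * walk_budget alpha s nr.
Proof.
rewrite /walk_budget [leRHS]mulrA ler_wpM2r ?mean_walk_cost_ge0 //.
rewrite [leRHS]mulrCA ler_wpM2l // ler_pM2l // ler_pdivlMl // -natrM ler_nat.
by rewrite mul2n -[leqRHS]odd_double_half leq_addl.
Qed.

Lemma min_push_budget_le (D z : R) nr rmax : 0 < z ->
  (forall t, t \in C -> 0 < rmax t) ->
  push_charge rmax * walk_budget alpha s nr <= D ->
  Num.min (push_all_cost alpha pick C (half rmax))%:R (walk_budget alpha s nr) <=
  #|C|%:R + (2 * D / z + z) / 2.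
Proof.
move=> z_gt0 rmax_gt0 le_D.
have half_gt0 t : t \in C -> 0 < half rmax t by move=> tC; rewrite mulr_gt0 ?rmax_gt0.
have le_2D : push_charge (half rmax) * walk_budget alpha s nr <= 2 * D.
  by rewrite push_charge_half -mulrA ler_pM2l.
have := min_le_AGM (push_charge_ge0 half_gt0) (walk_budget_ge0 nr) z_gt0 le_2D.
rewrite -(lerD2l #|C|%:R); apply: le_trans; rewrite addr_minr.
rewrite le_min !ge_min push_all_cost_le //=.
by rewrite lerDr ler0n orbT.
Qed.

Section LoopInvariant.
Variable Inv : nat -> (G -> R) -> Prop.
Hypothesis Inv_half : forall nr rmax, Inv nr rmax ->
  (push_all_cost alpha pick C (half rmax))%:R <= walk_budget alpha s nr ->
  Inv nr./2 (half rmax).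

Lemma phase2_loop_ind fuel nr rmax cost : Inv nr rmax ->
  let x := phase2_loop alpha pick s fuel C nr rmax cost in Inv x.1.1 x.1.2.
Proof.
elim: fuel nr rmax cost => [//|f IH] nr rmax cost inv /=.
by case: ltP => // completed; apply: IH; apply: Inv_half.
Qed.

Lemma phase2_loop_cost_le (work : R) fuel j nr rmax cost :
  C != finset.set0 -> #|C|%:R <= work ->
  (forall nr rmax, Inv nr rmax ->
     Num.min (push_all_cost alpha pick C (half rmax))%:R (walk_budget alpha s nr)
       <= work) ->
  Inv nr rmax -> (nr < 2 ^ j)%N ->
  (phase2_loop alpha pick s fuel C nr rmax cost).2%:R <=
  cost%:R + j.+1%:R * (2 * work + 1).
Proof.
move=> C_neq0 card_le min_le.
have work_ge0 : 0 <= work := le_trans (ler0n _ _) card_le.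
elim: fuel j nr rmax cost => [|f IH] j nr rmax cost inv nr_lt /=.
  by rewrite lerDl mulr_ge0 // addr_ge0 // mulr_ge0.
have := min_le _ _ inv; rewrite /half; case: ltP => [_|completed].
  move=> budget_le; rewrite natrD lerD2l -natr1.
  have : (Num.truncn (walk_budget alpha s nr))%:R <= walk_budget alpha s nr.
    by rewrite truncn_le walk_budget_ge0.
  have : 2 * work + 1 <= j.+1%:R * (2 * work + 1).
    by rewrite ler_peMl ?ler1n // addr_ge0 // mulr_ge0.
  by lra.
move=> push_le.
have nr_gt0 : (0 < nr)%N.
  rewrite lt0n; apply: contraTneq completed => ->.
  by rewrite /walk_budget !mulr0 mul0r -ltNge ltr0n push_all_cost_gt0.
case: j nr_lt => [|j] nr_lt; first by move: nr_lt; rewrite expn0 ltnS leqNgt nr_gt0.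
apply: le_trans (IH j _ _ _ (Inv_half inv completed) _) _.
  by rewrite ltn_half_double -mul2n -expnS.
rewrite !natrD -[in leRHS]natr1 -[#|C|.+1%:R]natr1 [in leRHS]mulrDl mul1r.
by move: push_le card_le; lra.
Qed.

End LoopInvariant.

(* Halving nr halves the budget and doubles the charge, so D bounds their product
   throughout the loop. *)
Lemma phase2_loop_bounds (D z work : R) j nr rmax :
  C != finset.set0 -> 0 < z -> #|C|%:R + (2 * D / z + z) / 2 <= work ->
  (nr < 2 ^ j)%N -> (forall t, t \in C -> 0 < rmax t) ->
  push_charge rmax * walk_budget alpha s nr <= D ->
  (push_all_cost alpha pick C rmax)%:R <= work ->
  let x := phase2_loop alpha pick s nr.+1 C nr rmax 0 in
  [/\ walk_budget alpha s x.1.1 <= work,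
      (push_all_cost alpha pick C x.1.2)%:R <= work &
      x.2%:R <= j.+1%:R * (2 * work + 1)].
Proof.
move=> C_neq0 z_gt0 scale_le nr_lt rmax_gt0 le_D push_le x.
pose Inv nr' rmax' := [/\ forall t, t \in C -> 0 < rmax' t,
  push_charge rmax' * walk_budget alpha s nr' <= D &
  (push_all_cost alpha pick C rmax')%:R <= work].
have min_le nr' rmax' : Inv nr' rmax' ->
    Num.min (push_all_cost alpha pick C (half rmax'))%:R (walk_budget alpha s nr') <= work.
  by case=> r_gt0 r_le_D _; apply: le_trans scale_le; apply: min_push_budget_le.
have Inv_half nr' rmax' : Inv nr' rmax' ->
    (push_all_cost alpha pick C (half rmax'))%:R <= walk_budget alpha s nr' ->
    Inv nr'./2 (half rmax').
  move=> inv completed; have := min_le _ _ inv; rewrite min_l //.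
  case: inv => r_gt0 r_le_D _ half_le; split=> // [t tC|]; first by rewrite mulr_gt0 ?r_gt0.
  apply: le_trans r_le_D; rewrite push_charge_half [2 * _]mulrC -mulrA.
  by rewrite ler_wpM2l ?push_charge_ge0 // -ler_pdivlMl // walk_budget_half.
have inv0 : Inv nr rmax by [].
have inv_x : Inv x.1.1 x.1.2 := phase2_loop_ind Inv_half _ 0 inv0.
have exits := phase2_loop_exits alpha pick s rmax 0 C_neq0 (ltnSn nr).
have D_ge0 : 0 <= D.
  by apply: le_trans le_D; rewrite mulr_ge0 ?push_charge_ge0 ?walk_budget_ge0.
have card_le : #|C|%:R <= work.
  apply: le_trans scale_le; rewrite lerDl divr_ge0 // addr_ge0 ?(ltW z_gt0) //.
  by rewrite divr_ge0 ?mulr_ge0 // ltW.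
split; last by rewrite -[leRHS]add0r (phase2_loop_cost_le Inv_half) //.
- by have := min_le _ _ inv_x; rewrite min_r // ltW.
- by case: inv_x.
Qed.

End Phase2Loop.

(** * The work for one source and one seed of RBS *)

Section LogarithmicCounts.
Variables (R : realType) (G : ugraph).
Hypothesis n_gt1 : (1 < order_of G)%N.
Let n : R := (order_of G)%:R.
Let n_gt0 : 0 < n. Proof. by rewrite ltr0n ltnW. Qed.

Lemma nt_le : (nt R G)%:R <= 56 * ln n.
Proof.
have half_le : 2^-1 <= ln n := half_le_ln_nat R n_gt1.
have ln2_le : ln 2 <= ln n by rewrite ler_ln ?posrE // (ler_nat R 2).
have ln2_ge0 : 0 <= ln 2 :> R by rewrite ln_ge0 // ler1n.
have lnE : ln (2 * n ^+ 2) = ln 2 + ln n *+ 2.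
  by rewrite lnM ?posrE ?exprn_gt0 // lnXn.
by apply: le_trans (ltW (natceil_ltD1 _)) _; rewrite -/n lnE mulr2n; lra.
Qed.

Lemma nr_init_lt_expn (eps : R) : 0 < eps -> n ^- 3 <= eps ->
  exists j, (nr_init G eps < 2 ^ j)%N /\ j.+1%:R <= 20 * ln n.
Proof.
move=> eps_gt0 le_eps; pose a := up_log 2 (order_of G).
have n_le : (order_of G <= 2 ^ a)%N by apply: up_logP.
exists (4 * a).+1; split.
  rewrite expnS -(ltr_nat R).
  apply: (lt_le_trans (natceil_ltD1 _)); first by rewrite divr_ge0 // ltW.
  apply: (@le_trans _ _ (n ^+ 4 + 1)).
    rewrite lerD2r ler_pdivrMr // -/n exprS -mulrA ler_peMr ?(ltW n_gt0) //.
    by rewrite -ler_pdivrMl ?exprn_gt0 // mulr1.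
  rewrite mul2n -addnn natrD lerD // ?ler1n ?expn_gt0 //.
  by rewrite mulnC expnM -natrX ler_nat leq_exp2r.
have half_le : 2^-1 <= ln n := half_le_ln_nat R n_gt1.
have half_le2 : 2^-1 <= ln 2 :> R by apply: (@half_le_ln_nat R 2).
have pred_le : a.-1%:R * ln 2 <= ln n.
  rewrite mulr_natl -lnXn // ler_ln ?posrE ?exprn_gt0 // -natrX ler_nat ltnW //.
  exact: up_log_gtn.
have a_gt0 : (0 < a)%N by rewrite up_log_gt0 n_gt1.
have -> : (4 * a).+2%:R = 4 * a.-1%:R + 6 :> R.
  by rewrite -{1}(prednK a_gt0) -natrM -natrD; congr _%:R; lia.
have : 0 <= a.-1%:R :> R by [].
nra.
Qed.

End LogarithmicCounts.

(* The free parameter z is the weight of the AM-GM inequality that bounds the work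
   of phase II. *)
Definition source_load (R : realType) (alpha : R) (G : ugraph) (eps z : R) (s : G) : R :=
  1 + z + inflow alpha s / eps + inflow alpha s / (eps ^+ 2 * z).

Section SourceLoad.
Variables (R : realType) (alpha : R) (G : ugraph) (eps z : R).
Hypotheses (alpha01 : 0 < alpha < 1) (eps_gt0 : 0 < eps) (z_gt0 : 0 < z).

Lemma inflow_terms_ge0 (s : G) :
  0 <= inflow alpha s / eps /\ 0 <= inflow alpha s / (eps ^+ 2 * z).
Proof.
by split; rewrite divr_ge0 ?inflow_ge0 // ?mulr_ge0 ?exprn_ge0 // ltW.
Qed.

Lemma source_load_ge1 (s : G) : 1 <= source_load alpha eps z s.
Proof.
have [x_ge0 y_ge0] := inflow_terms_ge0 s.
by rewrite /source_load -!addrA lerDl !addr_ge0 // ltW.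
Qed.

Lemma source_load_gez (s : G) : z <= source_load alpha eps z s.
Proof.
have [x_ge0 y_ge0] := inflow_terms_ge0 s.
by rewrite /source_load addrAC -!addrA addrCA lerDl !addr_ge0.
Qed.

Lemma inflow_div_le_source_load (s : G) :
  inflow alpha s / eps <= source_load alpha eps z s.
Proof.
have [x_ge0 y_ge0] := inflow_terms_ge0 s.
by rewrite /source_load addrAC lerDr !addr_ge0 // ltW.
Qed.

Lemma average_source_load : (0 < order_of G)%N ->
  \sum_(s : G) source_prob R s * source_load alpha eps z s =
  1 + z + (eps^-1 + (eps ^+ 2 * z)^-1) * ((order_of G)%:R / (2 * (size_of G)%:R)).
Proof.
move=> n_gt0; rewrite -(sum_source_prob_inflow G alpha01).
transitivity ((1 + z) * (\sum_(s : G) source_prob R s) +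
    (eps^-1 + (eps ^+ 2 * z)^-1) * \sum_(s : G) source_prob R s * inflow alpha s).
  rewrite !mulr_sumr -big_split /=.
  by apply: eq_bigr => s _; rewrite /source_load; ring.
by rewrite sum_source_prob // mulr1.
Qed.

End SourceLoad.

Definition density_scale (R : realType) (G : ugraph) (eps : R) : R :=
  eps^-1 * Num.sqrt ((order_of G)%:R / (size_of G)%:R).

Section DensityScale.
Variables (R : realType) (G : ugraph) (eps : R).
Hypotheses (eps_gt0 : 0 < eps) (order_gt0 : (0 < order_of G)%N).

Let n : R := (order_of G)%:R.
Let m : R := (size_of G)%:R.
Let r : R := Num.sqrt (n / m).
Let n_gt0 : 0 < n. Proof. by rewrite ltr0n. Qed.
Let m_gt0 : 0 < m. Proof. by rewrite ltr0n size_gt0. Qed.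
Let r_gt0 : 0 < r. Proof. by rewrite sqrtr_gt0 divr_gt0. Qed.
Let z : R := density_scale G eps.
Let r2E : r ^+ 2 = n / m. Proof. by rewrite sqr_sqrtr // divr_ge0 // ltW. Qed.

Lemma sqrt_density_le2 : r <= 2.
Proof.
rewrite -(@ler_pXn2r _ 2) ?nnegrE ?(ltW r_gt0) // r2E ler_pdivrMr //.
have n_le : n <= 2 * m by rewrite -natrM ler_nat order_le_size.
by rewrite (le_trans n_le) // ler_pM2r // expr2; lra.
Qed.

Lemma inv_order_le_sqrt_density : n^-1 <= r.
Proof.
rewrite -(@ler_pXn2r _ 2) ?nnegrE ?invr_ge0 ?(ltW n_gt0) ?(ltW r_gt0) // r2E exprVn.
rewrite ler_pdivlMr // ler_pdivrMl ?exprn_gt0 //.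
apply: (@le_trans _ _ (n ^+ 2 * 1)).
  by rewrite mulr1 -natrX ler_nat size_le_square.
by rewrite ler_wpM2l ?exprn_ge0 ?(ltW n_gt0) // ler1n.
Qed.

Lemma density_scale_gt0 : 0 < z.
Proof. by rewrite mulr_gt0 ?invr_gt0. Qed.

Lemma order_sqr_le_density_scale : eps < n ^- 3 -> n ^+ 2 <= z.
Proof.
move=> eps_small; rewrite /z /density_scale mulrC ler_pdivlMr //.
apply: le_trans inv_order_le_sqrt_density.
rewrite -ler_pdivlMl ?exprn_gt0 // -invfM mulrC -exprS.
exact: ltW.
Qed.

Lemma average_source_load_bounds (alpha : R) : 0 < alpha < 1 ->
  0 <= \sum_(s : G) source_prob R s * source_load alpha eps z s <= 4 * Num.max 1 z.
Proof.
move=> alpha01; have z_gt0 := density_scale_gt0; apply/andP; split.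
  apply: sumr_ge0 => s _.
  by rewrite mulr_ge0 ?source_prob_ge0 // (le_trans ler01) ?source_load_ge1.
rewrite average_source_load // -/n -/m.
have -> : (eps^-1 + (eps ^+ 2 * z)^-1) * (n / (2 * m)) = z * (r + 1) / 2.
  rewrite (_ : n / (2 * m) = r ^+ 2 / 2); last by rewrite r2E; field; rewrite gt_eqF.
  by rewrite /z /density_scale -/r; field; rewrite !gt_eqF.
have zr_le : z * r <= z * 2 by rewrite ler_pM2l // sqrt_density_le2.
have : 1 <= Num.max 1 z by rewrite le_max lexx.
have : z <= Num.max 1 z by rewrite le_max lexx orbT.
by lra.
Qed.

End DensityScale.

Section WorkFactors.
Variables (R : realType) (alpha : R).
Hypothesis alpha_gt0 : 0 < alpha.

(* In units of source_load: the number of candidates, the initial push charge, and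
   the product of push charge and walk budget. *)
Definition phase2_factor (trials : R) : R := 3 + 18 / alpha + 9 * trials / alpha ^+ 2.

(* The repetitions of phase II, its final pushes, and the sums and selections made
   for the trials. *)
Definition work_factor (reps trials : R) : R :=
  reps * (2 * phase2_factor trials + 1) + (1 + 3 * trials) * phase2_factor trials.

Lemma phase2_factor_ge0 trials : 0 <= trials -> 0 <= phase2_factor trials.
Proof.
by move=> trials_ge0; rewrite !addr_ge0 // divr_ge0 ?mulr_ge0 ?exprn_ge0 // ltW.
Qed.

Lemma work_factor_ge0 reps trials :
  0 <= reps -> 0 <= trials -> 0 <= work_factor reps trials.
Proof.
move=> reps_ge0 trials_ge0; have factor_ge0 := phase2_factor_ge0 trials_ge0.
by rewrite addr_ge0 // mulr_ge0 // addr_ge0 // mulr_ge0.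
Qed.

Lemma polylog_phase2_factor (trials : nat -> R) :
  polylog trials -> polylog (fun n => phase2_factor (trials n)).
Proof.
move=> poly_trials; apply: polylogD; first exact: polylog_cst.
apply: polylogM; last exact: polylog_cst.
by apply: polylogM => //; apply: polylog_cst.
Qed.

Lemma polylog_work_factor (reps trials : nat -> R) :
  polylog reps -> polylog trials -> polylog (fun n => work_factor (reps n) (trials n)).
Proof.
move=> poly_reps poly_trials; have poly_factor := polylog_phase2_factor poly_trials.
apply: polylogD; apply: polylogM => //; apply: polylogD; try exact: polylog_cst.
  by apply: polylogM => //; apply: polylog_cst.
by apply: polylogM => //; apply: polylog_cst.
Qed.

End WorkFactors.

Section Seed.
Variables (R : realType) (alpha : R) (Omega : Type) (rbs : rbs_routine R Omega).
Variables (pm : power_routine R) (tau : nat -> nat).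
Variables (G : ugraph) (pick : push_rule G) (eps : R) (s : G) (w : Omega).

Definition seed_time : \bar R :=
  \esum_(ws in [set: batch alpha rbs pick eps s w])
    (batch_prob alpha s ws * (algorithmD pm tau ws).2%:R)%:E.

Definition candidate_mass : R :=
  \sum_(t in candidates alpha rbs eps s w) ppr1 alpha rbs eps s w t / (deg t)%:R.

Hypotheses (alpha01 : 0 < alpha < 1) (eps_gt0 : 0 < eps).
Let alpha_gt0 : 0 < alpha. Proof. by case/andP: alpha01. Qed.
Let C := candidates alpha rbs eps s w.
Let nr0 := nr_init G eps.

Lemma seed_time_ge0 : (0 <= seed_time)%E.
Proof. by apply: esum_ge0 => ws _; rewrite lee_fin mulr_ge0 // batch_prob_ge0. Qed.

Lemma seed_time_le_affine (a b : R) : 0 <= a -> 0 <= b ->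
  (forall ws : batch alpha rbs pick eps s w,
     (algorithmD pm tau ws).2%:R <= a + b * \sum_x (walk_cost (ws x))%:R) ->
  (seed_time <= (a + b * ((nt R G * nr_final alpha rbs pick eps s w)%:R *
                          mean_walk_cost alpha s))%:E)%E.
Proof.
move=> a_ge0 b_ge0 cost_le.
have := esum_batch_affine_cost_le s
  ('I_(nt R G) * 'I_(nr_final alpha rbs pick eps s w))%type alpha01 a_ge0 b_ge0.
rewrite card_prod !card_ord; apply: le_trans; apply: le_esum => ws _.
by rewrite lee_fin ler_wpM2l ?batch_prob_ge0.
Qed.

Lemma algorithmD_cost_le_safeguard (ws : batch alpha rbs pick eps s w) :
  ((algorithmD pm tau ws).2 <= tau (order_of G) + (@pm G alpha s eps).2)%N.
Proof.
by rewrite /algorithmD; case: ifP => // /ltnW le_tau; rewrite (leq_trans le_tau) ?leq_addr.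
Qed.

Lemma seed_time_le_safeguard :
  (seed_time <= (tau (order_of G) + (@pm G alpha s eps).2)%:R%:E)%E.
Proof.
have := seed_time_le_affine (ler0n R (tau (order_of G) + (@pm G alpha s eps).2)) (lexx 0).
rewrite mul0r addr0; apply=> ws; rewrite mul0r addr0 ler_nat.
exact: algorithmD_cost_le_safeguard.
Qed.

Lemma candidate_gt t : t \in C -> 2^-1 * eps < ppr1 alpha rbs eps s w t / (deg t)%:R.
Proof. by rewrite inE. Qed.

Lemma candidate_ppr1_gt0 t : t \in C -> 0 < ppr1 alpha rbs eps s w t.
Proof.
move=> /candidate_gt; have half_gt0 : 0 < 2^-1 * eps by rewrite mulr_gt0.
by move=> /(lt_trans half_gt0); rewrite pmulr_lgt0 // invr_gt0 degr_gt0.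
Qed.

Lemma card_candidates_le : #|C|%:R <= 2 * candidate_mass / eps.
Proof.
rewrite ler_pdivlMr // -sum1_card natr_sum mulr_suml mulr_sumr.
by apply: ler_sum => t /candidate_gt /ltW; lra.
Qed.

Lemma nr_init_ge : 1 <= eps * nr0%:R.
Proof.
rewrite -ler_pdivrMl // mulr1 (le_trans _ (natceil_ge _)) ?divr_ge0 ?(ltW eps_gt0) //.
by rewrite -[leLHS]mul1r ler_pM2r ?invr_gt0 // ler1n ltnW // order_gt1.
Qed.

Let nr0_gt0 : 0 < nr0%:R :> R.
Proof. by have := lt_le_trans ltr01 nr_init_ge; rewrite pmulr_rgt0. Qed.

Lemma rmax_init_gt0 t : t \in C -> 0 < rmax_init alpha rbs eps s w t.
Proof.
move=> /candidate_ppr1_gt0 ppr1_gt0; apply: divr_gt0; last by rewrite mulr_gt0.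
by rewrite !mulr_gt0 ?exprn_gt0 ?degr_gt0.
Qed.

Lemma push_charge_init :
  push_charge alpha C (rmax_init alpha rbs eps s w) =
  12 * candidate_mass / (alpha * eps ^+ 2 * nr0%:R).
Proof.
rewrite mulr_sumr mulr_suml; apply: eq_bigr => t tC; rewrite /rmax_init.
by field; rewrite !gt_eqF ?degr_gt0 // candidate_ppr1_gt0.
Qed.

Section AccurateSeed.
Hypothesis accurate :
  rbs_accurate alpha s 2^-1 (4^-1 * eps * (deg s)%:R) (phase1 alpha rbs eps s w).1.

(* RBS returns at most ppr t s + delta < 2 * delta when ppr t s < delta, so
   every candidate t has ppr t s >= delta, and its relative error is 1/2. *)
Lemma candidate_mass_le : candidate_mass <= 3 / 2 * inflow alpha s.
Proof.
rewrite /inflow mulrA mulr_sumr mulr_suml.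
apply: (@le_trans _ _ (\sum_(t in C) 3 / 2 * ppr alpha t s / (deg s)%:R)).
  apply: ler_sum => t tC.
  have massE : ppr1 alpha rbs eps s w t / (deg t)%:R =
      (phase1 alpha rbs eps s w).1 t / (deg s)%:R.
    by rewrite /ppr1; field; rewrite !gt_eqF // degr_gt0.
  have := candidate_gt tC; rewrite massE ltr_pdivlMr ?degr_gt0 // => est_gt.
  rewrite ler_pM2r ?invr_gt0 ?degr_gt0 //.
  have [above below] := accurate t.
  have [large|small] := leP (4^-1 * eps * (deg s)%:R) (ppr alpha t s).
    by have := le_trans (ler_norm _) (above large); lra.
  by have := below small; lra.
rewrite [leRHS](bigID (mem C)) /= lerDl sumr_ge0 // => t _.
by rewrite divr_ge0 // mulr_ge0 // ppr_ge0.
Qed.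

Hypothesis pick_ok : push_rule_ok pick.
Variables (z reps trials : R) (halvings : nat).
Hypotheses (z_gt0 : 0 < z) (nt_le_trials : (nt R G)%:R <= trials).
Hypotheses (nr_lt : (nr0 < 2 ^ halvings)%N) (halvings_lt : halvings.+1%:R <= reps).

Let load := source_load alpha eps z s.
Let factor := phase2_factor alpha trials.
Let load_ge1 : 1 <= load. Proof. exact: source_load_ge1. Qed.
Let load_ge0 : 0 <= load. Proof. exact: le_trans load_ge1. Qed.
Let trials_ge0 : 0 <= trials. Proof. exact: le_trans nt_le_trials. Qed.

Let factor_terms_ge0 : 0 <= 18 / alpha /\ 0 <= 9 * trials / alpha ^+ 2.
Proof. by split; rewrite divr_ge0 ?mulr_ge0 ?exprn_ge0 // ltW. Qed.

Lemma card_candidates_le_inflow : #|C|%:R <= 3 * (inflow alpha s / eps).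
Proof.
apply: le_trans card_candidates_le _; rewrite mulrA ler_pM2r ?invr_gt0 //.
by have := candidate_mass_le; lra.
Qed.

Lemma push_charge_init_le :
  push_charge alpha C (rmax_init alpha rbs eps s w) <=
  18 * inflow alpha s / (alpha * eps ^+ 2 * nr0%:R).
Proof.
rewrite push_charge_init ler_pM2r ?invr_gt0 ?mulr_gt0 ?exprn_gt0 //.
by have := candidate_mass_le; lra.
Qed.

Lemma push_charge_budget_init_le :
  push_charge alpha C (rmax_init alpha rbs eps s w) * walk_budget alpha s nr0 <=
  9 * trials * inflow alpha s / (alpha ^+ 2 * eps ^+ 2).
Proof.
have -> : 9 * trials * inflow alpha s / (alpha ^+ 2 * eps ^+ 2) =
    18 * inflow alpha s / (alpha * eps ^+ 2 * nr0%:R) *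
    (trials * (2^-1 * nr0%:R) * alpha^-1).
  by field; rewrite !gt_eqF.
apply: ler_pM; rewrite ?push_charge_init_le ?walk_budget_ge0 //.
  by apply: push_charge_ge0 => // t; apply: rmax_init_gt0.
by rewrite ler_pM ?mulr_ge0 ?mean_walk_cost_ge0 ?mean_walk_cost_le // ler_wpM2r // mulr_ge0.
Qed.

Lemma balanced_work_le :
  #|C|%:R + (2 * (9 * trials * inflow alpha s / (alpha ^+ 2 * eps ^+ 2)) / z + z) / 2 <=
  factor * load.
Proof.
have [a_ge0 b_ge0] := factor_terms_ge0.
have [x_ge0 y_ge0] := inflow_terms_ge0 alpha01 eps_gt0 z_gt0 s.
apply: (@le_trans _ _ (3 * load + 9 * trials / alpha ^+ 2 * load)); last first.
  by rewrite -mulrDl ler_wpM2r // /factor /phase2_factor [leRHS]addrAC lerDl.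
rewrite (_ : (2 * _ / z + z) / 2 =
    z / 2 + 9 * trials / alpha ^+ 2 * (inflow alpha s / (eps ^+ 2 * z))); last first.
  by field; rewrite !gt_eqF.
rewrite addrA lerD // ?ler_wpM2l //.
  have := card_candidates_le_inflow; rewrite /load /source_load.
  by move: z_gt0 x_ge0 y_ge0; move: (_ / eps) (_ / (eps ^+ 2 * z)) => x y; lra.
by rewrite /load /source_load lerDr !addr_ge0 // ltW.
Qed.

Lemma push_all_cost_init_le :
  (push_all_cost alpha pick C (rmax_init alpha rbs eps s w))%:R <= factor * load.
Proof.
have [a_ge0 b_ge0] := factor_terms_ge0.
have [x_ge0 _] := inflow_terms_ge0 alpha01 eps_gt0 z_gt0 s.
have x_le := inflow_div_le_source_load alpha01 eps_gt0 z_gt0 s.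
apply: le_trans (push_all_cost_le alpha01 pick_ok rmax_init_gt0) _.
apply: (@le_trans _ _ ((3 + 18 / alpha) * load)); last first.
  by rewrite ler_wpM2r // lerDl.
rewrite mulrDl; apply: lerD.
  by apply: le_trans card_candidates_le_inflow _; rewrite ler_wpM2l.
apply: le_trans push_charge_init_le _.
apply: (@le_trans _ _ (18 / alpha * (inflow alpha s / eps))); last by rewrite ler_wpM2l.
have -> : 18 * inflow alpha s / (alpha * eps ^+ 2 * nr0%:R) =
    18 / alpha * (inflow alpha s / eps) / (eps * nr0%:R).
  by field; rewrite !gt_eqF.
by rewrite ler_pdivrMr ?mulr_gt0 // ler_peMr ?nr_init_ge // mulr_ge0.
Qed.

Lemma phase2_bounds :
  [/\ walk_budget alpha s (nr_final alpha rbs pick eps s w) <= factor * load,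
      (push_all_cost alpha pick C (rmax_final alpha rbs pick eps s w))%:R
        <= factor * load &
      (phase2 alpha rbs pick eps s w).2%:R
        <= halvings.+1%:R * (2 * (factor * load) + 1)].
Proof.
rewrite /nr_final /rmax_final /phase2 -/C; case: ifPn => [/eqP C0|C_neq0].
  have work_ge0 : 0 <= factor * load.
    by apply: le_trans push_all_cost_init_le.
  rewrite /= /walk_budget !mulr0 mul0r /push_all_cost C0 big_set0.
  by split=> //; rewrite mulr_ge0 // addr_ge0 // mulr_ge0.
apply: (phase2_loop_bounds alpha01 pick_ok C_neq0 z_gt0 balanced_work_le nr_lt).
- exact: rmax_init_gt0.
- exact: push_charge_budget_init_le.
- exact: push_all_cost_init_le.
Qed.

Lemma unguarded_cost_le (ws : batch alpha rbs pick eps s w) :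
  (unguarded ws).2%:R <=
    (phase1_cost alpha rbs eps s w)%:R + work_factor alpha reps trials * load
    + \sum_x (walk_cost (ws x))%:R.
Proof.
have [_ push_le loop_le] := phase2_bounds.
rewrite /= /phase2_cost /phase3_cost !natrD -natr_sum -/C !natrM.
set work := factor * load in push_le loop_le.
have work_ge0 : 0 <= work by apply: le_trans push_le.
have nnz_le : (\sum_(t in C) (nnz (residue (push_final alpha rbs pick eps s w t))).+1)%:R
    <= 2 * work.
  rewrite (le_trans _ (ler_wpM2l _ push_le)) // -natrM ler_nat big_distrr /=.
  apply: leq_sum => t _; rewrite mul2n -addnn -addn1 leq_add ?nnz_residue_backward_push //.
  exact: backward_push_cost_gt0.
have card_le : #|C|%:R <= work.
  apply: le_trans push_le; rewrite ler_nat -sum1_card; apply: leq_sum => t _.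
  exact: backward_push_cost_gt0.
have sums_le := ler_pM (ler0n R _) (ler0n R _) nt_le_trials nnz_le.
have select_le := ler_pM (ler0n R _) (ler0n R _) card_le nt_le_trials.
have loop_le_load : halvings.+1%:R * (2 * work + 1) <= reps * (2 * factor + 1) * load.
  have twice_work_ge0 : 0 <= 2 * work + 1 by rewrite addr_ge0 // mulr_ge0.
  by rewrite -mulrA ler_pM //; have := load_ge1; rewrite /work; lra.
have -> : work_factor alpha reps trials * load =
    reps * (2 * factor + 1) * load + (1 + 3 * trials) * work.
  by rewrite /work_factor /work /factor; ring.
by lra.
Qed.

Variable overhead : R.
Hypothesis overhead_ge1 : 1 <= overhead.
Hypothesis safeguard_le_tau :
  (tau (order_of G) + (@pm G alpha s eps).2)%:R <= overhead * (tau (order_of G))%:R.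

Lemma algorithmD_cost_le_unguarded (ws : batch alpha rbs pick eps s w) :
  (algorithmD pm tau ws).2%:R <= overhead * (unguarded ws).2%:R.
Proof.
rewrite /algorithmD; case: ifPn => [_|]; first by rewrite ler_peMl.
rewrite -leqNgt => le_tau; apply: (le_trans safeguard_le_tau).
by rewrite ler_wpM2l ?(le_trans ler01) // ler_nat.
Qed.

Lemma seed_time_le_load :
  (seed_time <= (overhead * ((phase1_cost alpha rbs eps s w)%:R +
                      (work_factor alpha reps trials + 2 * factor) * load))%:E)%E.
Proof.
have overhead_ge0 : 0 <= overhead := le_trans ler01 overhead_ge1.
have reps_ge0 : 0 <= reps := le_trans (ler0n _ _) halvings_lt.
have work_ge0 : 0 <= work_factor alpha reps trials by apply: work_factor_ge0.
pose base := (phase1_cost alpha rbs eps s w)%:R + work_factor alpha reps trials * load.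
apply: le_trans (seed_time_le_affine (a := overhead * base) _ overhead_ge0 _) _.
- by rewrite mulr_ge0 // /base addr_ge0 // mulr_ge0.
- move=> ws; rewrite -mulrDr.
  apply: le_trans (algorithmD_cost_le_unguarded ws) _.
  by rewrite ler_wpM2l ?unguarded_cost_le.
rewrite lee_fin -mulrDr ler_wpM2l // /base.
have [budget_le _ _] := phase2_bounds.
by move: budget_le; rewrite /walk_budget natrM; lra.
Qed.

End AccurateSeed.
End Seed.

(** * The expectation over the seed *)

Section SeedExpectation.
Context d (T : measurableType d) (R : realType).

(* The running time is not known to be measurable in the seed. *)
Lemma ge0_le_integral_nonmeasurable (mu : {measure set T -> \bar R}) (f g : T -> \bar R) :
  (forall x, (0 <= f x)%E) -> (forall x, (f x <= g x)%E) ->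
  (\int[mu]_x f x <= \int[mu]_x g x)%E.
Proof.
move=> f_ge0 fg; have g_ge0 x : (0 <= g x)%E := le_trans (f_ge0 x) (fg x).
rewrite !ge0_integralTE //; apply: ereal_sup_le => _ [h hf <-].
by exists h => // x; apply: le_trans (hf x) (fg x).
Qed.

Variable P : probability T R.

Lemma probability_integral_cst (a : R) : (\int[P]_x a%:E = a%:E)%E.
Proof. by rewrite -[RHS](expectation_cst P) unlock. Qed.

Lemma ge0_integral_affine (f : T -> R) (a b : R) :
  measurable_fun [set: T] f -> (forall x, 0 <= f x) -> 0 <= a -> 0 <= b ->
  (\int[P]_x (a * f x + b)%:E = a%:E * \int[P]_x (f x)%:E + b%:E)%E.
Proof.
move=> mf f_ge0 a_ge0 b_ge0.
have mEf : measurable_fun [set: T] (fun x => (f x)%:E : \bar R) by apply/measurable_EFinP.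
under eq_integral do rewrite EFinD EFinM.
rewrite ge0_integralD //; first last.
- exact: measurable_funeM.
- by move=> x _; rewrite -EFinM lee_fin mulr_ge0.
rewrite probability_integral_cst ge0_integralZl_EFin // => x _.
by rewrite lee_fin.
Qed.

Lemma ge0_integral_le_off_event (f g : T -> \bar R) (A : set T) (b p : R) :
  measurable A -> measurable_fun [set: T] g ->
  (forall x, (0 <= f x)%E) -> (forall x, (0 <= g x)%E) -> 0 <= b ->
  (forall x, A x -> (f x <= g x)%E) -> (forall x, (f x <= b%:E)%E) ->
  ((1 - p)%:E <= P A)%E ->
  (\int[P]_x f x <= \int[P]_x g x + (b * p)%:E)%E.
Proof.
move=> mA mg f_ge0 g_ge0 b_ge0 f_le_g f_le_b PA.
have mAc : measurable (~` A) by apply: measurableC.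
have m1 : measurable_fun [set: T] (fun x => (\1_(~` A) x : R)%:E).
  by apply/measurable_EFinP; apply: measurable_indic.
have mb1 : measurable_fun [set: T] (fun x => b%:E * (\1_(~` A) x : R)%:E)%E.
  exact: measurable_funeM.
have b1_ge0 x : (0 <= b%:E * (\1_(~` A) x : R)%:E)%E by rewrite mule_ge0 ?lee_fin.
apply: (@le_trans _ _ (\int[P]_x (g x + b%:E * (\1_(~` A) x : R)%:E))%E).
  apply: ge0_le_integral_nonmeasurable => // x.
  have [xA|xA] := pselect (A x); first by rewrite (le_trans (f_le_g x xA)) // leeDl.
  by rewrite (le_trans (f_le_b x)) // indicE mem_set // mule1 leeDr.
rewrite ge0_integralD // ge0_integralZl_EFin // leeD2l //.
rewrite integral_indic // setIT EFinM lee_wpmul2l ?lee_fin //.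
rewrite [leLHS](probability_setC P mA).
by move: PA; rewrite -(@fineK _ (P A)) ?fin_num_measure // lee_fin -EFinB lee_fin; lra.
Qed.

Lemma measurable_rbs_accurate (G : ugraph) (alpha : R) (t : G) (epsr delta : R)
    (est : T -> G -> R) :
  (forall v, measurable_fun [set: T] (fun x => est x v)) ->
  measurable [set x | rbs_accurate alpha t epsr delta (est x)].
Proof.
move=> mest.
have -> : [set x | rbs_accurate alpha t epsr delta (est x)] =
    \bigcap_(v in [set: G]) ([set: T] `&` (fun x => est x v) @^-1`
      (if delta <= ppr alpha v t then
        [set` `[ppr alpha v t - epsr * ppr alpha v t, ppr alpha v t + epsr * ppr alpha v t]]
       else [set` `]-oo, ppr alpha v t + delta]])).
  apply/seteqP; split=> x /= acc v.
    move=> _; split=> //; have [above below] := acc v.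
    have [large|small] := leP delta (ppr alpha v t); rewrite /= in_itv /=.
      by have := above large; rewrite ler_distl.
    exact: below.
  have [_ /=] := acc v I.
  by have [large|small] := leP delta (ppr alpha v t); rewrite /= in_itv /= => in_itv_v;
    split => // _; rewrite ler_distl.
apply: fin_bigcap_measurable; first exact: finite_finset.
by move=> v _; apply: mest => //; case: ifP.
Qed.

End SeedExpectation.

Section SourceTime.
Variables (R : realType) (alpha : R) (d : measure_display) (Omega : measurableType d).
Variables (P : probability Omega R) (rbs : rbs_routine R Omega).
Variables (pm : power_routine R) (tau : nat -> nat).
Variables (G : ugraph) (pick : push_rule G) (eps : R) (s : G).
Hypotheses (alpha01 : 0 < alpha < 1) (eps_gt0 : 0 < eps).
Let n : R := (order_of G)%:R.
Let safeguard_cost : R := (tau (order_of G) + (@pm G alpha s eps).2)%:R.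

Lemma expected_time_le_safeguard :
  (expected_time alpha P rbs pm tau pick eps s <= safeguard_cost%:E)%E.
Proof.
rewrite -(probability_integral_cst P); apply: ge0_le_integral_nonmeasurable => w.
  exact: seed_time_ge0.
exact: seed_time_le_safeguard.
Qed.

Hypothesis rbsP : rbs_spec P rbs.
Let phase1_time w : R := (phase1 alpha rbs eps s w).2%:R.

Definition accurate_seeds : set Omega :=
  [set w | rbs_accurate alpha s 2^-1 (4^-1 * eps * (deg s)%:R)
             (phase1 alpha rbs eps s w).1].

Lemma measurable_accurate_seeds : measurable accurate_seeds.
Proof. by apply: measurable_rbs_accurate => v; apply: (rbs_est_measurable rbsP). Qed.

Lemma phase1_failure_prob_bounds : 0 < n ^- 2 < 1.
Proof.
have n_gt1 : 1 < n by rewrite ltr1n (order_gt1 s).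
have n_gt0 : 0 < n := lt_trans ltr01 n_gt1.
by rewrite invr_gt0 exprn_gt0 //= invf_lt1 ?exprn_gt0 // exprn_egt1.
Qed.

Lemma probability_accurate_seeds : ((1 - n ^- 2)%:E <= P accurate_seeds)%E.
Proof.
apply: (rbs_correct rbsP) => //; last exact: phase1_failure_prob_bounds.
by rewrite !mulr_gt0 // degr_gt0.
Qed.

Hypothesis pick_ok : push_rule_ok pick.
Variables (z reps trials overhead rbs_factor : R) (halvings : nat).
Hypotheses (z_gt0 : 0 < z) (nt_le_trials : (nt R G)%:R <= trials).
Hypotheses (nr_lt : (nr_init G eps < 2 ^ halvings)%N)
  (halvings_lt : halvings.+1%:R <= reps).
Hypothesis overhead_ge1 : 1 <= overhead.
Hypothesis safeguard_le_tau : safeguard_cost <= overhead * (tau (order_of G))%:R.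
Let load := source_load alpha eps z s.
Let factor := work_factor alpha reps trials + 2 * phase2_factor alpha trials.
Let overhead_ge0 : 0 <= overhead. Proof. exact: le_trans overhead_ge1. Qed.

Lemma seed_time_le_phase1_time (w : Omega) : accurate_seeds w ->
  (seed_time alpha rbs pm tau pick eps s w <=
   (2 * overhead * phase1_time w + overhead * factor * load)%:E)%E.
Proof.
move=> accurate_w.
apply: (le_trans (seed_time_le_load alpha01 eps_gt0 accurate_w pick_ok z_gt0
  nt_le_trials nr_lt halvings_lt overhead_ge1 safeguard_le_tau)).
rewrite lee_fin mulrDr -[overhead * factor * load]mulrA lerD2r.
rewrite [2 * overhead]mulrC -mulrA ler_wpM2l // mulr_natl mulr2n natrD lerD2l ler_nat.
exact: (rbs_output_size rbsP).
Qed.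

Hypothesis safeguard_le_sqr : safeguard_cost <= overhead * n ^+ 2.
Hypothesis phase1_time_le : (\int[P]_w (phase1_time w)%:E <= (rbs_factor * load)%:E)%E.

(* The summand 1 pays for the failures of RBS: they have probability n^-2, and the
   safeguard then costs at most overhead * n^2. *)
Lemma expected_time_le_load :
  (expected_time alpha P rbs pm tau pick eps s <=
   (overhead * (2 * rbs_factor + factor + 1) * load)%:E)%E.
Proof.
have /andP[alpha_gt0 _] := alpha01.
have n_gt0 : 0 < n by rewrite ltr0n ltnW // (order_gt1 s).
have load_ge1 : 1 <= load := source_load_ge1 alpha01 eps_gt0 z_gt0 s.
have load_ge0 : 0 <= load := le_trans ler01 load_ge1.
have factor_ge0 : 0 <= factor.
  have trials_ge0 : 0 <= trials := le_trans (ler0n _ _) nt_le_trials.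
  have reps_ge0 : 0 <= reps := le_trans (ler0n _ _) halvings_lt.
  by rewrite addr_ge0 ?work_factor_ge0 // mulr_ge0 // phase2_factor_ge0.
have mtime : measurable_fun [set: Omega] phase1_time by exact: (rbs_time_measurable rbsP).
have split_le : (expected_time alpha P rbs pm tau pick eps s <=
    \int[P]_w (2 * overhead * phase1_time w + overhead * factor * load)%:E +
    (overhead * n ^+ 2 * n ^- 2)%:E)%E.
  apply: (ge0_integral_le_off_event measurable_accurate_seeds _ _ _ _
    seed_time_le_phase1_time _ probability_accurate_seeds).
  - by apply/measurable_EFinP; apply: measurable_funD => //; apply: measurable_funM.
  - by move=> w; apply: seed_time_ge0.
  - by move=> w; rewrite lee_fin addr_ge0 // !mulr_ge0.
  - by rewrite mulr_ge0 // exprn_ge0 // ltW.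
  - move=> w; apply: le_trans (seed_time_le_safeguard _ _ _ _ _ _ _ alpha01) _.
    by rewrite lee_fin.
apply: le_trans split_le _; rewrite mulfK ?gt_eqF ?exprn_gt0 //.
rewrite ge0_integral_affine ?mulr_ge0 //.
apply: (@le_trans _ _ ((2 * overhead)%:E * (rbs_factor * load)%:E +
    (overhead * factor * load)%:E + overhead%:E)%E).
  by rewrite leeD2r // leeD2r // lee_wpmul2l // lee_fin mulr_ge0.
have overhead_le : overhead <= overhead * load by rewrite ler_peMr.
by rewrite -EFinM -!EFinD lee_fin; lra.
Qed.

End SourceTime.

Lemma phase1_time_le_source_load (R : realType) (alpha : R) (d : measure_display)
    (Omega : measurableType d) (P : probability Omega R) (rbs : rbs_routine R Omega) :
  0 < alpha < 1 -> rbs_spec P rbs ->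
  exists rbs_factor : nat -> R, [/\ polylog rbs_factor, forall n, 0 <= rbs_factor n &
    forall (G : ugraph) (eps z : R) (s : G), 0 < eps -> 0 < z ->
      (\int[P]_w ((phase1 alpha rbs eps s w).2%:R)%:E <=
       (rbs_factor (order_of G) * source_load alpha eps z s)%:E)%E].
Proof.
move=> alpha01 rbsP; have half_gt0 : 0 < 2^-1 :> R by rewrite invr_gt0.
have [K [k rbs_le]] := rbs_time rbsP 2 alpha01 half_gt0.
exists (fun n => 4 * `|K| * ln n%:R ^+ k); split; first exact: polylog_monomial.
  by move=> n; rewrite !mulr_ge0 // exprn_ge0 // ln_nat_ge0.
move=> G eps z s eps_gt0 z_gt0; set load := source_load _ _ _ _.
have load_ge1 : 1 <= load := source_load_ge1 alpha01 eps_gt0 z_gt0 s.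
have delta_gt0 : 0 < 4^-1 * eps * (deg s)%:R by rewrite !mulr_gt0 // degr_gt0.
apply: le_trans (rbs_le G s _ _ delta_gt0 (phase1_failure_prob_bounds R s) (lexx _)) _.
rewrite lee_fin; apply: le_trans (soft_bound_le_norm _ _ _ _) _.
have -> : 4 * `|K| * ln (order_of G)%:R ^+ k * load =
    `|K| * ln (order_of G)%:R ^+ k * (4 * load) by ring.
rewrite ler_wpM2l ?mulr_ge0 ?exprn_ge0 ?ln_nat_ge0 //.
have -> : (order_of G)%:R * pagerank alpha s / (4^-1 * eps * (deg s)%:R) =
    4 * (inflow alpha s / eps).
  have n_gt0 : 0 < (order_of G)%:R :> R by rewrite ltr0n ltnW // (order_gt1 s).
  by rewrite /pagerank /inflow; field; rewrite !gt_eqF // degr_gt0.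
rewrite ge_max ler_pM2l // inflow_div_le_source_load // andbT.
by rewrite (le_trans load_ge1) // ler_peMl ?(le_trans ler01) // ler1n.
Qed.

Lemma safeguard_cost_le_overhead (R : realType) (alpha : R)
    (pm : power_routine R) (tau : nat -> nat) :
  power_time alpha pm -> theta_square R tau ->
  exists overhead : nat -> R, [/\ polylog overhead, forall n, 1 <= overhead n &
    forall (G : ugraph) (eps : R) (s : G), 0 < eps ->
      let n := order_of G in let cost := (tau n + (@pm G alpha s eps).2)%:R in
      cost <= overhead n * (tau n)%:R /\ cost <= overhead n * n%:R ^+ 2].
Proof.
move=> [K [k pm_le]] [a [b [a_gt0 b_gt0 tau_le]]].
pose mu n : R := `|K| * ln n%:R ^+ k.
have mu_ge0 n : 0 <= mu n by rewrite mulr_ge0 // exprn_ge0 // ln_nat_ge0.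
have poly_mu : polylog mu by exact: polylog_monomial.
exists (fun n => 1 + mu n / a + (b + mu n)); split.
- apply: polylogD; apply: polylogD => //; try exact: polylog_cst.
  by apply: polylogM => //; apply: polylog_cst.
- by move=> n; rewrite -addrA lerDl !addr_ge0 ?divr_ge0 // ltW.
move=> G eps s eps_gt0 n cost; have /andP[tau_ge tau_le_b] := tau_le n.
have n2_ge1 : 1 <= n%:R ^+ 2 :> R by rewrite exprn_ege1 // ler1n ltnW // order_gt1.
have pm_le_mu : (@pm G alpha s eps).2%:R <= mu n * n%:R ^+ 2.
  apply: le_trans (pm_le G s eps eps_gt0) _; apply: le_trans (soft_bound_le_norm _ _ _ _) _.
  by rewrite max_r.
rewrite /cost natrD; split.
- rewrite mulrDl -[leLHS]addr0; apply: lerD; last by rewrite mulr_ge0 // addr_ge0 // ltW.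
  rewrite mulrDl mul1r lerD2l (le_trans pm_le_mu) // -mulrA ler_wpM2l //.
  by rewrite ler_pdivlMl.
- rewrite mulrDl -[leLHS]add0r; apply: lerD.
    by rewrite mulr_ge0 ?exprn_ge0 // addr_ge0 // divr_ge0 // ltW.
  by rewrite mulrDl lerD.
Qed.

Lemma expected_time_le_polylog (R : realType) (alpha : R) (d : measure_display)
    (Omega : measurableType d) (P : probability Omega R) (rbs : rbs_routine R Omega)
    (pm : power_routine R) (tau : nat -> nat) :
  0 < alpha < 1 -> rbs_spec P rbs -> power_time alpha pm -> theta_square R tau ->
  exists Phi : nat -> R, polylog Phi /\
    forall (G : ugraph) (pick : push_rule G) (eps : R) (s : G),
      push_rule_ok pick -> 0 < eps ->
      (expected_time alpha P rbs pm tau pick eps s <=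
       (Phi (order_of G) * source_load alpha eps (density_scale G eps) s)%:E)%E.
Proof.
move=> alpha01 rbsP pmP tauP; have /andP[alpha_gt0 _] := alpha01.
have [rbs_factor [poly_rbs_factor rbs_factor_ge0 rbs_le]] :=
  phase1_time_le_source_load alpha01 rbsP.
have [overhead [poly_overhead overhead_ge1 safeguard_le]] :=
  safeguard_cost_le_overhead pmP tauP.
pose reps n : R := 20 * ln n%:R; pose trials n : R := 56 * ln n%:R.
have poly_reps : polylog reps by exact: polylog_monomial 1.
have poly_trials : polylog trials by exact: polylog_monomial 1.
pose factor n := work_factor alpha (reps n) (trials n) + 2 * phase2_factor alpha (trials n).
have factor_ge0 n : 0 <= factor n.
  have ln_ge0 := ln_nat_ge0 R n.
  by rewrite addr_ge0 ?work_factor_ge0 ?mulr_ge0 ?phase2_factor_ge0 ?mulr_ge0.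
exists (fun n => overhead n * (2 * rbs_factor n + factor n + 1)); split.
  apply: polylogM => //; apply: polylogD; last exact: polylog_cst.
  apply: polylogD; first by apply: polylogM => //; apply: polylog_cst.
  apply: polylogD; first exact: polylog_work_factor.
  by apply: polylogM; [exact: polylog_cst|exact: polylog_phase2_factor].
move=> G pick eps s pick_ok eps_gt0; set n := order_of G; set z := density_scale _ _.
have n_gt1 : (1 < n)%N := order_gt1 s.
have z_gt0 : 0 < z := density_scale_gt0 eps_gt0 (ltnW n_gt1).
have [safeguard_le_tau safeguard_le_sqr] := safeguard_le G eps s eps_gt0.
have [eps_large|eps_small] := leP (n%:R ^- 3) eps.
  have [halvings [nr_lt halvings_lt]] := nr_init_lt_expn n_gt1 eps_gt0 eps_large.
  exact: (expected_time_le_load alpha01 eps_gt0 rbsP pick_ok z_gt0 (nt_le R n_gt1)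
    nr_lt halvings_lt (overhead_ge1 n) safeguard_le_tau safeguard_le_sqr
    (rbs_le G eps z s eps_gt0 z_gt0)).
apply: le_trans (expected_time_le_safeguard P rbs pm tau pick eps s alpha01) _.
rewrite lee_fin; apply: (le_trans safeguard_le_sqr); rewrite -mulrA.
have overhead_ge0 : 0 <= overhead n := le_trans ler01 (overhead_ge1 n).
rewrite ler_wpM2l //; apply: (@le_trans _ _ (source_load alpha eps z s)).
  apply: le_trans _ (source_load_gez alpha01 eps_gt0 z_gt0 s).
  exact: order_sqr_le_density_scale eps_gt0 (ltnW n_gt1) eps_small.
rewrite ler_peMl //; last by rewrite lerDr addr_ge0 // mulr_ge0.
exact: le_trans ler01 (source_load_ge1 alpha01 eps_gt0 z_gt0 s).
Qed.

Theorem theorem21 (R : realType) (alpha : R)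
    (d : measure_display) (Omega : measurableType d) (P : probability Omega R)
    (rbs : rbs_routine R Omega) (pm : power_routine R) (tau : nat -> nat)
    (alpha01 : 0 < alpha < 1)
    (rbsP : rbs_spec P rbs)
    (pmP : power_time alpha pm)
    (tauP : theta_square R tau) :
  (exists c1 c2 : R, [/\ 0 < c1, 0 < c2 &
     forall (G : ugraph) (eps : R), 0 < eps ->
       let f := eps^-1 * ((order_of G)%:R / (size_of G)%:R) in
       c1 * f <=
         \sum_(s : G) source_prob R s *
            (eps^-1 * \sum_(t : G) ppr alpha s t / (deg t)%:R)
       <= c2 * f]) /\
  (exists (K : R) (k : nat),
     forall (G : ugraph) (pick : push_rule G) (eps : R),
       push_rule_ok pick -> 0 < eps ->
       (\sum_(s : G) (source_prob R s)%:E *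
          expected_time alpha P rbs pm tau pick eps s <=
        (soft_bound K k (order_of G)
           (eps^-1 * Num.sqrt ((order_of G)%:R / (size_of G)%:R)))%:E)%E).
Proof.
split.
  exists 2^-1, 2^-1; split; [by rewrite invr_gt0|by rewrite invr_gt0|].
  by move=> G eps _ /=; rewrite average_source_lower_boundE // lexx.
have [Phi [polyPhi time_le]] := expected_time_le_polylog alpha01 rbsP pmP tauP.
have [K [k [K_ge0 soft_le]]] := polylog_mul_le_soft_bound polyPhi (ler0n R 4).
exists K, k => G pick eps pick_ok eps_gt0.
have [order0|n_gt0] := posnP (order_of G).
  rewrite big1 ?lee_fin ?soft_bound_ge0 // => s _.
  by have := order_gt1 s; rewrite order0.
have [v _] := card_gt0P n_gt0.
have load_bounds := average_source_load_bounds eps_gt0 n_gt0 alpha01.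
apply: (@le_trans _ _ (Phi (order_of G) * _)%:E); last first.
  by rewrite lee_fin; apply: soft_le (order_gt1 v) load_bounds.
rewrite mulr_sumr -sumEFin; apply: lee_sum => s _.
by rewrite mulrCA (EFinM (source_prob R s)) lee_wpmul2l ?lee_fin ?source_prob_ge0 ?time_le.
Qed.
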